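(* Let $n\in\mathbb{N}$, $n\ge1$, and let real numbers $s_{m,k}$, $0\le k\le m\le 2n-2$, be given with $s_{0,0}=n$. There exist $n\times n$ Hermitian matrices $P$ and $R$ such that $$\sum_{|w|=m,\ \mathrm{na}(R)=k}\mathrm{tr}\, w(P,R)=s_{m,k}\qquad\text{for all }0\le k\le m\le 2n-2,$$ if and only if the Hankel-valued matrix polynomial $H(y):=(h_{r+s}(y))_{r,s=0}^{n-1}$, where $h_m(y)=\sum_{k=0}^m s_{m,k}\,y^k$ for $0\le m\le 2n-2$, is positive semidefinite for all $y\in\mathbb{R}$ and the polynomials $p_1(y),\dots,p_{2n-2}(y)$ defined recursively by $$p_1(y)=-h_1(y),\qquad p_j(y)=-\frac1j\Big(h_j(y)+\sum_{k=1}^{j-1}h_k(y)\,p_{j-k}(y)\Big)\quad(2\le j\le 2n-2)$$ satisfy $p_j(y)\equiv0$ for all $j$ with $n+1\le j\le 2n-2$.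
   Context: The sum $\sum_{|w|=m,\ \mathrm{na}(R)=k}$ is over all words $w$ of length $m$ in two (noncommuting) letters in which the second letter (the one replaced by $R$) appears exactly $k$ times; $w(P,R)$ is the matrix product obtained by substituting $P$ and $R$ for the letters, the empty word giving the identity matrix $I_n$. For example, for $m=2,k=1$ the sum is $\mathrm{tr}(PR)+\mathrm{tr}(RP)$. Hermitian means complex Hermitian. A condition over an empty range of indices is vacuous. *)

(* Defs.v *)
From mathcomp Require Import all_boot all_order all_algebra.
From mathcomp Require Import reals.
From mathcomp Require Import complex.

Set Implicit Arguments.
Unset Strict Implicit.
Unset Printing Implicit Defensive.

Import Order.TTheory GRing.Theory Num.Theory.

Local Open Scope ring_scope.
Local Open Scope complex_scope.

(* Words in two letters are Boolean tuples: [false] stands for the first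
   letter and [true] for the second one. *)
Definition word_eval (C : nzRingType) (n : nat) (P Q : 'M[C]_n)
    (w : seq bool) : 'M[C]_n :=
  \big[mulmx/1%:M]_(b <- w) (if b then Q else P).

Definition word_trace_sum (C : nzRingType) (n : nat) (P Q : 'M[C]_n)
    (m k : nat) : C :=
  \sum_(w : m.-tuple bool | count_mem true w == k) \tr (word_eval P Q w).

Definition psdmx (R : realType) (n : nat) (A : 'M[R]_n) : Prop :=
  A^T = A /\ forall v : 'cV[R]_n, 0 <= (v^T *m A *m v) 0 0.

Definition hpoly (R : realType) (s : nat -> nat -> R) (m : nat) : {poly R} :=
  \sum_(0 <= k < m.+1) s m k *: 'X^k.

Definition hankel_mx (R : realType) (h : nat -> {poly R}) (n : nat) :
    'M[{poly R}]_n :=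
  \matrix_(r < n, t < n) h (r + t)%N.

(* The list [:: p_j; ...; p_1]: every step of the recursion uses all the
   previous terms. *)
Fixpoint newton_seq (R : realType) (h : nat -> {poly R}) (j : nat) :
    seq {poly R} :=
  if j is i.+1 then
    let ps := newton_seq h i in
    (- (j%:R^-1 *: (h j + \sum_(1 <= k < j) h k * ps`_k.-1))) :: ps
  else [::].

Definition newton (R : realType) (h : nat -> {poly R}) (j : nat) : {poly R} :=
  head 0 (newton_seq h j).

Lemma nth_newton_seq (R : realType) (h : nat -> {poly R}) (j i : nat) :
  (newton_seq h j)`_i = newton h (j - i).
Proof. by elim: j i => [|j IHj] [|i] //=. Qed.

Lemma newton1 (R : realType) (h : nat -> {poly R}) : newton h 1 = - h 1%N.
Proof. by rewrite /newton /= big_geq // addr0 invr1 scale1r. Qed.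

Lemma newtonE (R : realType) (h : nat -> {poly R}) (j : nat) : (0 < j)%N ->
  newton h j =
    - (j%:R^-1 *: (h j + \sum_(1 <= k < j) h k * newton h (j - k))).
Proof.
case: j => // j _; rewrite {1}/newton /=.
congr (- (_ *: (_ + _))); apply: eq_big_nat => -[//|k] _.
by rewrite nth_newton_seq subSS.
Qed.

(* Main.v *)
Require Import Defs.
From mathcomp Require Import all_boot all_order all_algebra all_fingroup.
From mathcomp Require Import zify ring lra.
From mathcomp Require Import reals.
From mathcomp Require Import complex polyrcf.
From mathcomp Require boolp classical_sets topology normedtype derive.

(** The coefficient of y^k in tr (P + yR)^m is the sum of the traces of the words of length m
    with k letters R (coef_trace_pencil), so the moment conditions say that
    tr (P + yR)^m = h_m(y). In one direction, the eigenvalues of P + yR at real y are n real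
    numbers with power sums h_m(y). The form of H(y) is therefore a sum of squares, and by
    Newton's identities p_j(y) is the coefficient of x^(n-j) in the characteristic polynomial,
    which is 0 for j > n.

    The converse asks for a Hermitian determinantal representation of
    q(x, y) = x^n + p_1(y) x^(n-1) + ... + p_n(y). Newton's identities give h_m as the power
    sums of the roots, and Hermite's criterion (real_roots_of_psd) makes these roots real for
    every real y. The representation is built in three steps.

    - Perturbation. With d^2 = t (1 + y^2), half the sum of q(x + i d, y) and q(x - i d, y) is
      again a polynomial in x and y of the same shape. For t > 0 its roots in x are real
      (translate_roots_real) and simple (translate_roots_simple), at every real y and also at
      y = infinity (psd_top).

    - Construction (hermitian_pencil). Let H be the Hankel matrix of the perturbed power sums
      and c the matrix of multiplication by x, which is self-adjoint for H. Now H is positive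
      definite on the real line and its determinant has no zero at infinity, so one factor d
      collects the half of the zeros lying in the upper half plane. The polynomial rows of
      bounded degree that are divisible by the corresponding factor of H form a space of
      dimension n on which the form of H^-1 is constant and positive definite. In an
      orthonormal basis of it, c acts by a Hermitian matrix without poles and of degree at
      most one in y, that is by P + yR. The basis is a spectral factor of H, and it exists by
      a dimension count (root_extraction).

    - Limit. The entries of P and R are bounded by the traces of P^2 and R^2, so compactness
      allows t to tend to 0 (pencil_limit). *)

Set Implicit Arguments.
Unset Strict Implicit.
Unset Printing Implicit Defensive.

Import Order.TTheory GRing.Theory Num.Theory.

Local Open Scope ring_scope.

(** * Extraction of roots of a determinant *)

Definition polyC_mx (C : nzRingType) (m n : nat) (A : 'M[C]_(m, n)) :
  'M[{poly C}]_(m, n) := map_mx polyC A.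

Definition eval_mx (C : nzRingType) (m n : nat) (a : C) (A : 'M[{poly C}]_(m, n)) :
  'M[C]_(m, n) := map_mx (horner^~ a) A.

Lemma eval_mxE (C : comNzRingType) m n (a : C) (A : 'M[{poly C}]_(m, n)) :
  eval_mx a A = map_mx (horner_eval a) A.
Proof. by []. Qed.

Lemma eval_mxM (C : comNzRingType) m n p (a : C) (A : 'M[{poly C}]_(m, n)) (B : 'M_(n, p)) :
  eval_mx a (A *m B) = eval_mx a A *m eval_mx a B.
Proof. by rewrite !eval_mxE map_mxM. Qed.

Lemma eval_polyC_mx (C : comNzRingType) m n (a : C) (A : 'M[C]_(m, n)) :
  eval_mx a (polyC_mx A) = A.
Proof. by apply/matrixP=> i j; rewrite !mxE hornerC. Qed.

(** An elementary polynomial matrix of determinant X - a, adapted to a vector u with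
    u_(i0) = 1: it is a right factor of any matrix that kills u at a. *)
Definition root_factor (C : nzRingType) n (a : C) (u : 'cV[C]_n) (i0 : 'I_n) :
  'M[{poly C}]_n :=
  \matrix_(i, j) if j == i0 then (if i == i0 then 'X - a%:P else - (u i 0)%:P)
                 else (i == j)%:R.

Lemma det_root_factor (C : comNzRingType) n (a : C) (u : 'cV[C]_n) (i0 : 'I_n) :
  \det (root_factor a u i0) = 'X - a%:P.
Proof.
rewrite (expand_det_row _ i0) (bigD1 i0) //= big1 => [|j ji0]; last first.
  by rewrite mxE (negbTE ji0) eq_sym (negbTE ji0) mul0r.
rewrite addr0 mxE !eqxx /cofactor addnn -signr_odd odd_double expr0 mul1r.
rewrite (_ : row' _ _ = 1%:M) ?det1 ?mulr1 //.
apply/matrixP=> i j; rewrite !mxE eq_sym (negbTE (neq_lift _ _)).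
by rewrite (inj_eq lift_inj).
Qed.

(** Z is B with column i0 replaced by B u / (X - a). *)
Lemma root_factorP (C : fieldType) m n (a : C) (u : 'cV[C]_n) (i0 : 'I_n)
    (B : 'M[{poly C}]_(m, n)) :
  u i0 0 = 1 -> eval_mx a B *m u = 0 -> exists Z, B = Z *m root_factor a u i0.
Proof.
move=> ui0 Bu0; pose v := B *m polyC_mx u.
have vE i : exists q, v i 0 = q * ('X - a%:P).
  apply/factor_theorem/rootP; have := congr1 (fun M : 'cV_m => M i 0) Bu0.
  by rewrite -[u in _ *m u](eval_polyC_mx a) -eval_mxM !mxE.
pose q i := v i 0 %/ ('X - a%:P).
have qE i : q i * ('X - a%:P) = v i 0.
  by rewrite divpK // dvdp_XsubCl; apply/factor_theorem/vE.
exists (\matrix_(i, j) if j == i0 then q i else B i j).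
apply/matrixP=> i j; rewrite mxE (bigD1 i0) //= !mxE eqxx.
case: (altP (j =P i0)) => [->|ji0]; last first.
  rewrite eq_sym (negbTE ji0) mulr0 add0r (bigD1 j) //= big1 => [|k /andP[ki kj]].
    by rewrite !mxE eqxx (negbTE ji0) mulr1 addr0.
  by rewrite !mxE (negbTE kj) (negbTE ji0) mulr0.
rewrite qE mxE (bigD1 i0) //= mxE ui0 mulr1 -addrA -big_split /= big1 ?addr0 // => k ki0.
by rewrite !mxE eqxx (negbTE ki0) mulrN subrr.
Qed.

(** Independence of the rows over the constants, not over the polynomials. *)
Definition polyC_free (C : nzRingType) m n (W : 'M[{poly C}]_(m, n)) :=
  forall x : 'rV[C]_m, polyC_mx x *m W = 0 -> x = 0.

Lemma row_free_sub (C : fieldType) k m n (A : 'M[C]_(m, n)) :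
  (k <= \rank A)%N -> exists2 X : 'M_(k, n), row_free X & (X <= A)%MS.
Proof.
move=> kA; exists ((pid_mx k : 'M_(k, \rank A)) *m row_base A); last first.
  by apply: submx_trans (submxMl _ _) _; rewrite eq_row_base.
rewrite /row_free mxrankMfree ?row_base_free // rank_pid_mx //.
Qed.

(** A kernel vector of A(a) splits an elementary right factor off A, and divisibility of the
    rows of W by that factor is a single linear condition over C. So every root, counted with
    multiplicity, costs at most one dimension; a count of n conditions per root would be too
    crude for hermitian_pencil. *)
Lemma root_extraction (C : fieldType) n (rs : seq C) :
  forall (A : 'M[{poly C}]_n) k m (W : 'M[{poly C}]_(m, n)),
  (k + size rs <= m)%N -> polyC_free W ->
  \prod_(a <- rs) ('X - a%:P) %| \det A ->
  exists A' F (X : 'M[C]_(k, m)) (Z : 'M[{poly C}]_(k, n)),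
  [/\ A = A' *m F, \det F = \prod_(a <- rs) ('X - a%:P), row_free X
    & polyC_mx X *m W = Z *m F].
Proof.
elim: rs => [|a rs IH] A k m W; rewrite ?addn0 => km Wfree dA.
  have /row_free_sub[X Xf _] : (k <= \rank (1%:M : 'M[C]_m))%N by rewrite mxrank1.
  exists A, 1%:M, X, (polyC_mx X *m W).
  by rewrite !mulmx1 det1 big_nil; split.
have [v vn0 Av] : exists2 v : 'rV[C]_n, v != 0 & v *m (eval_mx a A)^T = 0.
  apply/det0P; rewrite det_tr eval_mxE det_map_mx /=.
  rewrite /horner_eval -[_ == 0]/(root _ _) -dvdp_XsubCl.
  by apply: dvdp_trans dA; rewrite big_cons dvdp_mulr.
have [i0 vi0] : exists i0, v 0 i0 != 0.
  apply/existsP; apply: contraNT vn0; rewrite negb_exists => /forallP v0.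
  by apply/eqP/rowP=> i; rewrite mxE; apply/eqP; have := v0 i; rewrite negbK.
pose u := (v 0 i0)^-1 *: v^T.
have ui0 : u i0 0 = 1 by rewrite !mxE mulVf.
have Au : eval_mx a A *m u = 0.
  by rewrite /u -scalemxAr -[_ *m _]trmxK trmx_mul trmxK Av trmx0 scaler0.
have [A1 A1E] := root_factorP ui0 Au.
have [X1 X1f X1s] : exists2 X : 'M_(k + size rs, m), row_free X &
    (X <= kermx (eval_mx a W *m u))%MS.
  apply: row_free_sub; rewrite mxrank_ker leq_subRL ?rank_leq_row //.
  apply: leq_trans km; rewrite /= addnS -[X in (_ <= X)%N]add1n.
  by rewrite leq_add2r; apply: rank_leq_col.
have [Z1 Z1E] : exists Z, polyC_mx X1 *m W = Z *m root_factor a u i0.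
  apply: root_factorP ui0 _; rewrite eval_mxM eval_polyC_mx -mulmxA.
  by apply/sub_kermxP.
have Z1f : polyC_free Z1.
  move=> x xZ; have : x *m X1 = 0.
    apply: Wfree; rewrite /polyC_mx map_mxM -mulmxA Z1E mulmxA.
    by rewrite -/(polyC_mx x) xZ mul0mx.
  by move/eqP; rewrite mulmx_free_eq0 // => /eqP.
have dA1 : \prod_(a <- rs) ('X - a%:P) %| \det A1.
  move: dA; rewrite A1E det_mulmx det_root_factor big_cons mulrC dvdp_mul2r //.
  by rewrite polyXsubC_eq0.
have [A' [F [X [Z [AE dF Xf ZE]]]]] := IH A1 k _ Z1 (leqnn _) Z1f dA1.
exists A', (F *m root_factor a u i0), (X *m X1), Z; split.
- by rewrite mulmxA -AE.
- by rewrite det_mulmx dF det_root_factor big_cons mulrC.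
- by rewrite /row_free mxrankMfree.
by rewrite /polyC_mx map_mxM -mulmxA Z1E !mulmxA ZE.
Qed.

(** * Conjugation and degrees of polynomial matrices *)

Local Open Scope sesquilinear_scope.

Lemma size_det_weighted (R : comNzRingType) n (A : 'M[{poly R}]_n) (a b : 'I_n -> nat) :
  (forall i j, size (A i j) <= (a i + b j).+1)%N ->
  (size (\det A) <= (\sum_i a i + \sum_j b j).+1)%N.
Proof.
move=> sA; apply: leq_trans (size_sum _ _ _) _; apply/bigmax_leqP=> s _.
rewrite size_Msign; apply: leq_trans (size_prod_leq _ _) _.
rewrite leq_subLR addnS ltnS (reindex_inj (@perm_inj _ s) (F := b)).
rewrite -big_split -sum1_card -big_split /=; apply: leq_sum => i _.
by rewrite add1n.
Qed.

Lemma double_sum_ord n : ((\sum_(i < n) i).*2 = n * n.-1)%N.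
Proof.
rewrite -(big_mkord xpredT id) bin2_sum bin2 halfK.
by case: n => //= m; rewrite oddM /= andNb subn0.
Qed.

(** Each of the two copies of 0 + 1 + ... + (n - 1) that bound the degree of the determinant
    loses one term. The bound is additive because natural subtraction truncates. *)
Lemma size_adj_hankel (R : comNzRingType) n (H : 'M[{poly R}]_n) (r s : 'I_n) :
  (forall r s, size (H r s) <= (r + s).+1)%N ->
  (size (\adj H r s) + r + s <= (n * n.-1).+1)%N.
Proof.
move=> sH; rewrite mxE size_Msign.
have sM : (size (\det (row' s (col' r H))) <=
    (\sum_i lift s i + \sum_j lift r j).+1)%N.
  by apply: size_det_weighted => i j; rewrite !mxE.
have tri (t : 'I_n) : (t + \sum_i lift t i = \sum_(i < n) i)%N.
  by rewrite [RHS](bigD1_ord t).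
have := tri r; have := tri s; rewrite -double_sum_ord.
move: sM; move: (size (polyseq _)) (\sum_i lift s i)%N (\sum_i lift r i)%N.
by move: (\sum_(i < n) i)%N => T d a b; clear; lia.
Qed.

(** Only the coefficients are conjugated, so that evaluation at a real point turns this into
    the conjugate transpose. *)
Definition cadj (C : numClosedFieldType) m n (A : 'M[{poly C}]_(m, n)) :
  'M[{poly C}]_(n, m) := map_mx (map_poly Num.conj) A^T.

Section Cadj.
Variable C : numClosedFieldType.
Implicit Types (f : {poly C}).

Lemma conj_polyK : involutive (map_poly (@Num.conj C)).
Proof. by move=> f; apply/polyP=> i; rewrite !coef_map /= conjCK. Qed.

Lemma horner_conj_poly f y : (map_poly Num.conj f).[y] = (f.[y^*])^*.
Proof. by rewrite -[y in LHS]conjCK horner_map. Qed.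

Lemma cadjK m n (A : 'M[{poly C}]_(m, n)) : cadj (cadj A) = A.
Proof. by apply/matrixP=> i j; rewrite !mxE conj_polyK. Qed.

Lemma cadjM m n p (A : 'M[{poly C}]_(m, n)) (B : 'M_(n, p)) :
  cadj (A *m B) = cadj B *m cadj A.
Proof. by rewrite /cadj trmx_mul map_mxM. Qed.

Lemma cadjZ m n f (A : 'M[{poly C}]_(m, n)) :
  cadj (f *: A) = map_poly Num.conj f *: cadj A.
Proof. by rewrite /cadj linearZ /= map_mxZ. Qed.

Lemma cadj_adj n (A : 'M[{poly C}]_n) : cadj (\adj A) = \adj (cadj A).
Proof. by rewrite /cadj trmx_adj map_mx_adj. Qed.

Lemma det_cadj n (A : 'M[{poly C}]_n) : \det (cadj A) = map_poly Num.conj (\det A).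
Proof. by rewrite /cadj det_map_mx det_tr. Qed.

Lemma cadj_polyC m n (A : 'M[C]_(m, n)) : cadj (polyC_mx A) = polyC_mx (A^t*).
Proof. by apply/matrixP=> i j; rewrite !mxE map_polyC. Qed.

Lemma eval_cadj m n y (A : 'M[{poly C}]_(m, n)) : y \is Num.real ->
  eval_mx y (cadj A) = (eval_mx y A)^t*.
Proof. by move=> yR; apply/matrixP=> i j; rewrite !mxE horner_conj_poly (conj_Creal yR). Qed.

Lemma trmxC_mul m n p (A : 'M[C]_(m, n)) (B : 'M_(n, p)) :
  (A *m B)^t* = B^t* *m A^t*.
Proof. by rewrite trmx_mul map_mxM. Qed.

(** The roots are not real and come in conjugate pairs; d collects those of the upper half
    plane. *)
Lemma real_poly_split f : f != 0 -> map_poly Num.conj f = f ->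
  (forall y, y \is Num.real -> f.[y] != 0) ->
  exists rs : seq C, let d := \prod_(a <- rs) ('X - a%:P) in
    f = lead_coef f *: (d * map_poly Num.conj d) /\
    coprimep d (map_poly Num.conj d).
Proof.
move=> fn0 fc fR; have [s fs] := closed_field_poly_normal f.
have lfn0 : lead_coef f != 0 by rewrite lead_coef_eq0.
have lfc : (lead_coef f)^* = lead_coef f.
  by rewrite -{2}fc lead_coef_map_eq // conjC_eq0.
pose S := \prod_(a <- s) ('X - a%:P).
have Sc : \prod_(a <- map Num.conj s) ('X - a%:P) = S.
  apply: (scalerI lfn0); rewrite -fs -[in RHS]fc [in RHS]fs map_polyZ /= lfc.
  by rewrite map_prod_XsubC big_map.
have /prod_XsubC_eq sc := Sc.
have sn0 x : x \in s -> 'Im x != 0.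
  move=> xs; apply: contraL (xs) => /eqP/Creal_ImP/fR; rewrite fs hornerZ.
  by rewrite mulf_eq0 negb_or -[_.[x] == 0]/(root _ x) root_prod_XsubC => /andP[].
exists [seq a <- s | 0 < 'Im a] => d.
have dc : map_poly Num.conj d = \prod_(a <- s | ~~ (0 < 'Im a)) ('X - a%:P).
  rewrite map_prod_XsubC -(big_map Num.conj xpredT (fun a => 'X - a%:P)) -[RHS]big_filter.
  apply: perm_big; rewrite (_ : map _ _ = [seq a <- map Num.conj s | 0 < 'Im a^*]); last first.
    by rewrite filter_map; congr map; apply: eq_filter => a /=; rewrite conjCK.
  apply: perm_trans (perm_filter _ sc) _.
  rewrite (@eq_in_filter _ _ (fun a => ~~ (0 < 'Im a))) // => a /sn0.
  by rewrite Im_conj oppr_gt0 -real_leNgt ?Creal_Im ?real0 // lt_neqAle => ->.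
split; first rewrite dc /d big_filter fs lead_coefZ lead_coef_prod_XsubC mulr1.
  by rewrite [in LHS](bigID (fun a => 0 < 'Im a)).
rewrite dc /d big_filter -[X in coprimep _ X]big_filter.
have: all (fun a => ~~ (0 < 'Im a)) [seq a <- s | ~~ (0 < 'Im a)] by apply: filter_all.
elim: {fs S Sc sc sn0 d dc} s [seq a <- s | _] => [|b s IH] t tP.
  by rewrite big_nil coprime1p.
rewrite big_cons; case: ifP => b0; last exact: IH.
rewrite coprimepMl IH // andbT coprimep_sym coprimep_XsubC root_prod_XsubC.
by apply/negP => /(allP tP); rewrite b0.
Qed.

End Cadj.

(** * Staircase rows and orthonormal bases *)

(** The pairs (s, j) with j <= s, indexing the monomials X^j in column s of the rows whose
    entry s has degree at most s. *)
Definition staircase n := {s : 'I_n & 'I_s.+1}.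

Lemma card_staircase n : (#|{: staircase n}|.*2 = n * n.+1)%N.
Proof.
rewrite card_tagged sumnE big_map big_enum /= (eq_bigr (fun i : 'I_n => i.+1)) => [|i _].
  elim: n => [|n IH]; first by rewrite big_ord0.
  by rewrite big_ord_recr /= doubleD IH; lia.
by rewrite card_ord.
Qed.

Definition monomial_rows (C : nzRingType) n : 'M[{poly C}]_(#|{: staircase n}|, n) :=
  \matrix_(t, s) let: existT s' j := (enum_val t : staircase n) in
    if s' == s then 'X^j else 0.

Lemma monomial_rowsE (C : nzRingType) n m (X : 'M[C]_(m, _)) i s :
  (polyC_mx X *m monomial_rows C n) i s =
  \poly_(j < s.+1) X i (enum_rank (Tagged (fun s : 'I_n => 'I_s.+1) (inord j : 'I_s.+1))).
Proof.
pose tg := fun t : 'I_#|{: staircase n}| => tag (enum_val t : staircase n).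
rewrite mxE poly_def (bigID (fun t => tg t == s)) /= addrC big1 ?add0r => [|t].
  rewrite (reindex (fun j : 'I_s.+1 =>
      enum_rank (Tagged (fun s : 'I_n => 'I_s.+1) j))) /=.
    apply: eq_big => [j|j _]; first by rewrite /tg enum_rankK eqxx.
    by rewrite !mxE enum_rankK /= eqxx inord_val mul_polyC.
  exists (fun t => inord (tagged (enum_val t : staircase n))) => [j _|t].
    by rewrite enum_rankK inord_val.
  rewrite unfold_in /tg /= => /eqP; case E: (enum_val t) => [s' j] /= ss'.
  by subst s'; rewrite inord_val; apply: enum_val_inj; rewrite enum_rankK E.
by rewrite !mxE /tg; case: (enum_val t) => s' j /= /negbTE ->; rewrite mulr0.
Qed.

Lemma size_monomial_rows (C : nzRingType) n m (X : 'M[C]_(m, _)) i s :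
  (size ((polyC_mx X *m monomial_rows C n) i s) <= s.+1)%N.
Proof. by rewrite monomial_rowsE size_poly. Qed.

Lemma monomial_rows_free (C : nzRingType) n : polyC_free (monomial_rows C n).
Proof.
move=> x x0; apply/rowP=> t; rewrite mxE -(enum_valK t).
case: (enum_val t) => s j.
have := congr1 (fun M : 'M[{poly C}]_(1, n) => (M 0 s : {poly C})`_j) x0.
by rewrite monomial_rowsE coef_poly ltn_ord inord_val !mxE coef0.
Qed.

(** The weights of adj H are opposite to those of the rows of U and the columns of V, so that
    only the excesses e1 and e2 survive. *)
Lemma size_sandwich (R : comNzRingType) n m p (H : 'M[{poly R}]_n) e1 e2
    (U : 'M[{poly R}]_(m, n)) (V : 'M[{poly R}]_(n, p)) i j :
  (forall r s, size (H r s) <= (r + s).+1)%N ->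
  (forall i r, size (U i r) <= r.+1 + e1)%N ->
  (forall s j, size (V s j) <= s.+1 + e2)%N ->
  (size ((U *m \adj H *m V) i j) <= (n * n.-1).+1 + e1 + e2)%N.
Proof.
move=> sH sU sV; rewrite mxE; apply: leq_trans (size_sum _ _ _) _.
apply/bigmax_leqP=> s _; rewrite mxE big_distrl /=.
apply: leq_trans (size_sum _ _ _) _; apply/bigmax_leqP=> r _.
have := size_adj_hankel r s sH; have := sU i r; have := sV s j.
have := size_polyMleq (U i r * \adj H r s) (V s j).
have := size_polyMleq (U i r) (\adj H r s).
move: (size (polyseq (U i r * \adj H r s * V s j))) => a.
move: (size (polyseq (U i r * \adj H r s))) (size (polyseq (U i r))) => b c.
move: (size (polyseq (V s j))) (size (polyseq (\adj H r s))) => d e.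
clear; lia.
Qed.

Section PosDef.
Variable C : numClosedFieldType.

(** L is an orthonormal eigenbasis rescaled by the inverse square roots of the eigenvalues. *)
Lemma posdef_orthonormal n (G : 'M[C]_n) : G^t* = G ->
  (forall x : 'rV_n, x != 0 -> 0 < (x *m G *m x^t* ) 0 0) ->
  exists2 L, L \in unitmx & L *m G *m L^t* = 1%:M.
Proof.
move=> Gh Gpos.
have Gherm : G \is hermsymmx by apply/is_hermitianmxP; rewrite expr0 scale1r Gh.
have /orthomx_spectralP GE := hermitian_normalmx Gherm.
have Pu := spectral_unitarymx G; set P := spectralmx G in GE Pu *.
set d := spectral_diag G in GE.
have PG : P *m G *m P^t* = diag_mx d.
  rewrite {1}GE !mulmxA mulmxV ?unitarymx_unit // mul1mx.
  by rewrite -[_ *m _ *m _]mulmxA (unitarymxP Pu) mulmx1.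
have dpos i : 0 < d 0 i.
  have -> : d 0 i = (row i P *m G *m (row i P)^t* ) 0 0.
    have := congr1 (fun M : 'M_n => M i i) PG.
    rewrite /= [in X in _ = X -> _]mxE eqxx mulr1n => <-.
    by rewrite -row_mul !mxE; apply: eq_bigr => k _; rewrite !mxE.
  apply: Gpos; apply/negP => /eqP Pi0.
  have := congr1 (fun M : 'M_n => M i i) (unitarymxP Pu).
  rewrite !mxE eqxx big1 => [/esym/eqP|k _]; first by rewrite oner_eq0.
  by have /rowP/(_ k) := Pi0; rewrite !mxE => ->; rewrite mul0r.
pose e := diag_mx (\row_i (sqrtC (d 0 i))^-1).
have eh : e^t* = e.
  rewrite /e tr_diag_mx map_diag_mx; congr diag_mx; apply/rowP=> i; rewrite !mxE.
  by apply: conj_Creal; rewrite rpredV; apply: sqrtC_real; apply: ltW.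
exists (e *m P).
  rewrite unitmx_mul (unitarymx_unit Pu) andbT unitmxE det_diag unitfE.
  by apply/prodf_neq0 => i _; rewrite mxE invr_eq0 sqrtC_eq0 gt_eqF.
rewrite trmxC_mul eh -!mulmxA [P *m _]mulmxA [P *m _ *m _]mulmxA PG.
rewrite mulmxA !mulmx_diag; apply/matrixP=> i j; rewrite !mxE.
case: eqP => // _; rewrite !mulr1n.
by rewrite mulrAC -expr2 exprVn sqrtCK mulVf // gt_eqF.
Qed.

End PosDef.

(** * Hermitian pencils from positive definite matrix polynomials *)

Lemma scalemxI (R : idomainType) m n (f : R) : f != 0 ->
  injective (fun A : 'M[R]_(m, n) => f *: A).
Proof.
move=> fn0 A B AB; apply/matrixP=> i j; apply: (mulfI fn0).
by have /matrixP/(_ i j) := AB; rewrite !mxE.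
Qed.

Lemma mulmx_scalar_comm (R : idomainType) n (f : R) (Q B : 'M[R]_n) :
  f != 0 -> Q *m B = f%:M -> B *m Q = f%:M.
Proof.
move=> fn0 QB; have dQ : \det Q != 0.
  have := congr1 determinant QB; rewrite det_mulmx det_scalar => dQB.
  by apply: contraNneq (expf_neq0 n fn0) => dQ0; rewrite -dQB dQ0 mul0r.
apply: (scalemxI dQ); rewrite -mul_scalar_mx -mul_adj_mx -mulmxA (mulmxA Q) QB.
by rewrite mul_scalar_mx -scalemxAr mul_adj_mx scale_scalar_mx mulrC -scale_scalar_mx.
Qed.

(** The identity F A^-1 = A'^-1, freed of denominators. *)
Lemma adj_factor (R : idomainType) n (A A' F : 'M[R]_n) :
  A = A' *m F -> \det A' != 0 -> F *m \adj A = \det F *: \adj A'.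
Proof.
move=> AE dA'; apply: (scalemxI dA').
rewrite -mul_scalar_mx -mul_adj_mx -mulmxA (mulmxA A') -AE mul_mx_adj AE.
by rewrite det_mulmx mul_mx_scalar scalerA.
Qed.

(** Multiplied by det Q = Q adj Q, both traces become the trace of Q c^m adj Q. *)
Lemma similar_trace (R : idomainType) n (M Q c : 'M[R]_n) m :
  \det Q != 0 -> M *m Q = Q *m c -> \tr (M ^+ m) = \tr (c ^+ m).
Proof.
move=> dQ MQ; have MQm : M ^+ m *m Q = Q *m c ^+ m.
  elim: m => [|m IH]; first by rewrite !expr0 mul1mx mulmx1.
  by rewrite !exprSr -mulmxE -mulmxA MQ !mulmxA IH.
apply: (mulfI dQ); rewrite -!mxtraceZ -mul_scalar_mx -mul_mx_adj.
rewrite mxtrace_mulC mulmxA MQm mxtrace_mulC mulmxA mul_adj_mx.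
by rewrite mul_scalar_mx.
Qed.

Lemma exists_nat_nonroot (C : numDomainType) (f : {poly C}) : f != 0 ->
  exists k : nat, f.[k%:R] != 0.
Proof.
move=> fn0; pose s := [seq k%:R : C | k <- iota 0 (size f)].
have : ~~ all (root f) s.
  apply/negP => rs; have s_uniq : uniq s.
    by rewrite map_inj_uniq ?iota_uniq // => a b /eqP; rewrite eqr_nat => /eqP.
  by have := max_poly_roots fn0 rs s_uniq; rewrite size_map size_iota ltnn.
by case/allPn => _ /mapP[k _ ->] /negP kf; exists k; apply/negP.
Qed.

Section HermitianPencil.
Variables (C : numClosedFieldType) (n : nat) (H c : 'M[{poly C}]_n).
Hypothesis Hherm : cadj H = H.
Hypothesis Hc : H *m c = cadj c *m H.
Hypothesis sizeH : forall r s, (size (H r s) <= (r + s).+1)%N.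
Hypothesis sizec : forall m (w : 'M[{poly C}]_(m, n)),
  (forall i s, size (w i s) <= s.+1)%N ->
  forall i s, (size ((w *m c) i s) <= s.+1 + 1)%N.
Hypothesis Hpos : forall y (v : 'cV[C]_n), y \is Num.real -> v != 0 ->
  0 < (v^t* *m eval_mx y H *m v) 0 0.
Hypothesis sizeD : (n * n.-1 < size (\det H))%N.

Let D := \det H.

Lemma pencil_D_neq0 : D != 0.
Proof. by rewrite -size_poly_gt0; apply: leq_ltn_trans sizeD. Qed.

Lemma pencil_D_conj : map_poly Num.conj D = D.
Proof. by rewrite -det_cadj Hherm. Qed.

Lemma pencil_D_real y : y \is Num.real -> D.[y] != 0.
Proof.
move=> yR; apply/negP => Dy0.
have /det0P[v vn0 v0] : \det (eval_mx y H) == 0 by rewrite eval_mxE det_map_mx.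
have vtn0 : v^t* != 0.
  by apply: contraNneq vn0 => v0'; rewrite -[v]trmxCK v0' trmx0 map_mx0.
by have := Hpos yR vtn0; rewrite trmxCK v0 mul0mx mxE ltxx.
Qed.

Lemma pencil_size_D : size D = (n * n.-1).+1.
Proof.
apply/eqP; rewrite eqn_leq sizeD andbT.
have := @size_det_weighted _ _ H val val sizeH; rewrite addnn.
by rewrite double_sum_ord.
Qed.

(** U adj H V / D is the pairing U H^-1 V. The left factor clears the poles of H^-1 in the
    upper half plane, the right one those in the lower half plane, and there are none on the
    real line; the weights bound the degree of what remains. *)
Lemma pencil_divide m p (U : 'M[{poly C}]_(m, n)) (V : 'M_(n, p)) d Y Y' e1 e2 :
  D = lead_coef D *: (d * map_poly Num.conj d) ->
  coprimep d (map_poly Num.conj d) ->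
  U *m \adj H = d *: Y -> \adj H *m V = map_poly Num.conj d *: Y' ->
  (forall i r, size (U i r) <= r.+1 + e1)%N ->
  (forall s j, size (V s j) <= s.+1 + e2)%N ->
  exists2 G, U *m \adj H *m V = D *: G
    & forall i j, (size (G i j) <= 1 + e1 + e2)%N.
Proof.
move=> DE cop UY VY sU sV.
pose N := U *m \adj H *m V.
have dvdN i j : D %| N i j.
  rewrite DE dvdpZl ?lead_coef_eq0 ?pencil_D_neq0 // Gauss_dvdp //.
  rewrite {1}/N UY -scalemxAl mxE dvdp_mulr //=.
  by rewrite /N -mulmxA VY -scalemxAr mxE dvdp_mulr.
exists (map_mx (fun f => f %/ D) N).
  apply/matrixP=> i j; rewrite [RHS]mxE [X in D * X]mxE.
  by rewrite mulrC divpK.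
move=> i j; rewrite mxE size_divp ?pencil_D_neq0 // pencil_size_D /=.
rewrite leq_subLR !addnA addn1; exact: size_sandwich.
Qed.

(** Rows of polynomials carry the form u H^-1 v^* , for which multiplication by c on the right
    is self-adjoint. Consider the rows w with deg w_s <= s that are divisible by F, the part of
    H with determinant d. There are n (n + 1) / 2 monomials and deg d = n (n - 1) / 2
    conditions, so n independent rows remain. On them the form takes values without poles and
    of degree zero: it is a constant positive definite matrix, so an orthonormal basis Q exists.
    In this basis c becomes a Hermitian polynomial matrix M with M Q = Q c, of degree at most
    one because c raises degrees by at most one. Hence M = P + yR. *)
Theorem hermitian_pencil : exists P R : 'M[C]_n,
  [/\ P \is hermsymmx, R \is hermsymmx &
      forall m, \tr ((polyC_mx P + 'X *: polyC_mx R) ^+ m) = \tr (c ^+ m)].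
Proof.
have Dn0 := pencil_D_neq0.
have [rs /=] := real_poly_split Dn0 pencil_D_conj pencil_D_real.
set d := \prod_(a <- rs) _ => -[DE cop].
pose W := monomial_rows C n.
have dimW : (n + size rs <= #|{: staircase n}|)%N.
  have := pencil_size_D; rewrite DE size_scale ?lead_coef_eq0 //.
  have dn0 : d != 0 by rewrite monic_neq0 // monic_prod_XsubC.
  rewrite size_mul ?map_poly_eq0 //.
  rewrite size_map_poly /d size_prod_XsubC.
  have := card_staircase n; clear; nia.
have dH : d %| \det H by rewrite -/D DE dvdpZr ?lead_coef_eq0 // dvdp_mulr.
have [A' [F [X [Z [HE dF Xfree XW]]]]] :=
  root_extraction dimW (@monomial_rows_free C n) dH.
have dA' : \det A' != 0.
  by apply: contraNneq Dn0 => dA'0; rewrite /D HE det_mulmx dA'0 mul0r.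
have [Q0 Q0E] : exists Q0, Q0 = polyC_mx X *m W by exists (polyC_mx X *m W).
have Q0Y : Q0 *m \adj H = d *: (Z *m \adj A').
  by rewrite Q0E XW -mulmxA (adj_factor HE dA') dF scalemxAr.
have adjHh : cadj (\adj H) = \adj H by rewrite cadj_adj Hherm.
have YQ0 : \adj H *m cadj Q0 = map_poly Num.conj d *: cadj (Z *m \adj A').
  by rewrite -adjHh -cadjM Q0Y cadjZ.
have sQ0 i s : (size (Q0 i s) <= s.+1 + 0)%N by rewrite addn0 Q0E size_monomial_rows.
have scadj (m : nat) (U : 'M[{poly C}]_(m, n)) e : (forall i s, size (U i s) <= s.+1 + e)%N ->
    forall s i, (size (cadj U s i) <= s.+1 + e)%N.
  by move=> sU s i; rewrite !mxE size_map_poly.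
have [G GE sG] := pencil_divide DE cop Q0Y YQ0 sQ0 (scadj _ _ _ sQ0).
pose G0 := eval_mx 0 G.
(* no excess degree on either side: here e1 = e2 = 0 in pencil_divide *)
have GC : G = polyC_mx G0.
  apply/matrixP=> i j; rewrite !mxE horner_coef0; apply: size1_polyC.
  exact: sG.
have G0h : G0^t* = G0.
  have Gh : cadj G = G.
    apply: (scalemxI Dn0); rewrite /= -{1}pencil_D_conj -cadjZ -GE.
    by rewrite !cadjM cadjK adjHh mulmxA.
  by rewrite /G0 -eval_cadj ?Gh ?real0.
have G0pos (x : 'rV_n) : x != 0 -> 0 < (x *m G0 *m x^t* ) 0 0.
  move=> xn0; pose w := polyC_mx x *m Q0.
  have wn0 : w != 0.
    apply: contraNneq xn0 => w0; have xX : x *m X = 0.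
      apply: (@monomial_rows_free C n); rewrite /polyC_mx map_mxM -mulmxA.
      by rewrite -/(polyC_mx X) -Q0E.
    by rewrite -(mulmx_free_eq0 _ Xfree) xX.
  have [s ws] : exists s, w 0 s != 0.
    apply/existsP; apply: contraNT wn0; rewrite negb_exists => /forallP w0.
    by apply/eqP/rowP=> i; rewrite [RHS]mxE; apply/eqP; have := w0 i; rewrite negbK.
  have [k wk] := exists_nat_nonroot ws; set y := k%:R in wk.
  have yR : y \is Num.real by apply: realn.
  (* V is D times the inverse of H applied to the adjoint of w *)
  pose V := \adj H *m cadj w.
  have VHV : cadj V *m H *m V = polyC_mx (x *m G0 *m x^t* ) * (D * D)%:M.
    rewrite /V cadjM cadjK adjHh -[w *m _ *m H]mulmxA mul_adj_mx -/D mul_mx_scalar.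
    rewrite -scalemxAl mulmxA /w cadjM cadj_polyC.
    rewrite -[_ *m _ *m \adj H]mulmxA -[_ *m (_ *m \adj H) *m _]mulmxA.
    rewrite [Q0 *m \adj H *m _]mulmxA GE GC.
    rewrite /polyC_mx !map_mxM -[_ * _%:M]/(_ *m _) mul_mx_scalar -scalemxAl -scalemxAr.
    by rewrite !mulmxA scalerA.
  have Vn0 : eval_mx y V != 0.
    apply: contraNneq wk => Vy0.
    have : eval_mx y (H *m V) = 0 by rewrite eval_mxM Vy0 mulmx0.
    rewrite /V mulmxA mul_mx_adj -/D mul_scalar_mx => /matrixP/(_ s 0).
    rewrite !mxE hornerM => /eqP; rewrite mulf_eq0 (negbTE (pencil_D_real yR)) /=.
    by rewrite horner_conj_poly conjC_eq0 (conj_Creal yR).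
  have := Hpos yR Vn0; rewrite -eval_cadj // -!eval_mxM VHV.
  rewrite -[_ * _%:M]/(_ *m _) eval_mxM eval_polyC_mx mxE big_ord1 mulrC.
  rewrite pmulr_rgt0 // !mxE eqxx mulr1n hornerM -expr2.
  have DR : D.[y] \is Num.real.
    by apply/CrealP; rewrite -{1}(conj_Creal yR) -horner_conj_poly pencil_D_conj.
  by rewrite real_exprn_even_gt0 // pencil_D_real.
have [L Lu LG] := posdef_orthonormal G0h G0pos.
have [Q QE] : exists Q, Q = polyC_mx L *m Q0 by exists (polyC_mx L *m Q0).
pose Y := polyC_mx L *m (Z *m \adj A').
have QY : Q *m \adj H = d *: Y by rewrite QE -mulmxA Q0Y -scalemxAr.
have YQ : \adj H *m cadj Q = map_poly Num.conj d *: cadj Y.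
  by rewrite -adjHh -cadjM QY cadjZ.
have QQ : Q *m (\adj H *m cadj Q) = D%:M.
  rewrite QE cadjM cadj_polyC !mulmxA -2!(mulmxA (polyC_mx L)) GE GC.
  rewrite -scalemxAr -scalemxAl /polyC_mx -!map_mxM LG map_scalar_mx /=.
  by rewrite scale_scalar_mx mulr1.
have sQ i s : (size (Q i s) <= s.+1)%N.
  rewrite QE Q0E mulmxA /polyC_mx -map_mxM; exact: size_monomial_rows.
(* self-adjointness of c, transported from H to its inverse *)
have cadjH : c *m \adj H = \adj H *m cadj c.
  apply: (scalemxI Dn0); rewrite -mul_scalar_mx -[D%:M]mul_adj_mx -!mulmxA.
  by rewrite (mulmxA H) Hc -(mulmxA (cadj c)) mul_mx_adj !mul_mx_scalar -scalemxAr.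
have UY : Q *m c *m \adj H = d *: (Y *m cadj c).
  by rewrite -mulmxA cadjH mulmxA QY -scalemxAl.
have sQ' i s : (size (Q i s) <= s.+1 + 0)%N by rewrite addn0.
have [M ME sM] := pencil_divide DE cop UY YQ (sizec sQ) (scadj _ _ _ sQ').
have Mh : cadj M = M.
  apply: (scalemxI Dn0); rewrite /= -{1}pencil_D_conj -cadjZ -ME.
  by rewrite !cadjM cadjK adjHh -!mulmxA (mulmxA (\adj H)) -cadjH !mulmxA.
have MQ : M *m Q = Q *m c.
  apply: (scalemxI Dn0); rewrite /= scalemxAl -ME -!mulmxA.
  by rewrite [\adj H *m _]mulmxA (mulmx_scalar_comm Dn0 QQ) !mul_mx_scalar -scalemxAr.
pose P := map_mx (coefp 0) M; pose R := map_mx (coefp 1) M.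
have coefh k : (map_mx (coefp k) M)^t* = map_mx (coefp k) M.
  by rewrite -[in RHS]Mh; apply/matrixP=> i j; rewrite !mxE /coefp coef_map.
exists P, R; split; try by apply/is_hermitianmxP; rewrite expr0 scale1r coefh.
have -> : polyC_mx P + 'X *: polyC_mx R = M.
  apply/matrixP=> i j; rewrite !mxE /coefp; apply/polyP=> k.
  rewrite coefD coefXM !coefC; case: k => [|[|k]]; rewrite ?addr0 ?add0r //=.
  by rewrite nth_default //; apply: leq_trans (sM i j) _.
move=> m; apply: similar_trace MQ.
have := congr1 determinant QQ; rewrite det_mulmx det_scalar => dQQ.
by apply: contraNneq (expf_neq0 n Dn0) => dQ0; rewrite -dQQ dQ0 mul0r.
Qed.

End HermitianPencil.

(** * Power sums and Newton's identities *)

(** Newton's recursion without division, so that it commutes with every ring morphism. The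
    list holds the values in degrees m, ..., 1, the last one computed coming first. *)
Fixpoint psum_seq (A : comNzRingType) (p : nat -> A) (m : nat) : seq A :=
  if m is i.+1 then
    let hs := psum_seq p i in
    - (m%:R * p m + \sum_(1 <= k < m) p k * hs`_k.-1) :: hs
  else [::].

Definition psum (A : comNzRingType) (n : nat) (p : nat -> A) (m : nat) : A :=
  if m is 0 then n%:R else head 0 (psum_seq p m).

Lemma nth_psum_seq (A : comNzRingType) n (p : nat -> A) m i : (i < m)%N ->
  (psum_seq p m)`_i = psum n p (m - i).
Proof.
elim: m i => [|m IHm] [|i] //= im.
by rewrite subSS; apply: IHm.
Qed.

Lemma psumE (A : comNzRingType) n (p : nat -> A) m : (0 < m)%N ->
  psum n p m = - (m%:R * p m + \sum_(1 <= k < m) p k * psum n p (m - k)).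
Proof.
case: m => // m _; rewrite {1}/psum /=.
congr (- (_ + _)); apply: eq_big_nat => -[//|k] /andP[_ km].
by rewrite (nth_psum_seq n) ?subSS.
Qed.

Lemma psum_uniq (A : comNzRingType) n (p h : nat -> A) M :
  h 0%N = n%:R ->
  (forall m, (0 < m <= M)%N ->
     h m + m%:R * p m + \sum_(1 <= k < m) p k * h (m - k)%N = 0) ->
  forall m, (m <= M)%N -> h m = psum n p m.
Proof.
move=> h0 hN; elim/ltn_ind => -[_ //|m IH] mM.
have /eqP := hN m.+1 mM; rewrite -addrA addr_eq0 => /eqP ->.
rewrite psumE //; congr (- (_ + _)); apply: eq_big_nat => k /andP[k0 km].
by rewrite IH //; lia.
Qed.

Lemma psum_morph (A B : comNzRingType) (f : {rmorphism A -> B}) n (p : nat -> A) m :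
  f (psum n p m) = psum n (f \o p) m.
Proof.
apply: (@psum_uniq _ n (f \o p) (fun m => f (psum n p m)) m) => // [|k /andP[k0 _]].
  by rewrite rmorph_nat.
rewrite psumE // rmorphN rmorphD rmorphM rmorph_nat rmorph_sum /=.
under eq_bigr do rewrite rmorphM.
by rewrite /=; ring.
Qed.

Lemma eq_psum (A : comNzRingType) n (p p' : nat -> A) M :
  (forall k, (0 < k <= M)%N -> p k = p' k) ->
  forall m, (m <= M)%N -> psum n p m = psum n p' m.
Proof.
move=> pp'; apply: psum_uniq => // m /andP[m0 mM].
rewrite psumE // -pp' ?m0 //.
rewrite (@eq_big_nat _ _ _ 1 m _ (fun k => p' k * psum n p (m - k))); first by ring.
by move=> k /andP[k0 km]; rewrite pp' //; lia.
Qed.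

Definition rev_roots (A : comNzRingType) (l : seq A) : {poly A} :=
  \prod_(a <- l) (1 - a *: 'X).

Lemma rev_roots_cons (A : comNzRingType) a (l : seq A) k :
  (rev_roots (a :: l))`_k =
  (rev_roots l)`_k - a * (if k is k'.+1 then (rev_roots l)`_k' else 0).
Proof.
by rewrite /rev_roots big_cons mulrBl mul1r -scalerAl coefB coefZ coefXM; case: k.
Qed.

Lemma coef_rev_roots (A : comNzRingType) (l : seq A) k :
  (rev_roots l)`_k =
  if (k <= size l)%N then (\prod_(a <- l) ('X - a%:P))`_(size l - k) else 0.
Proof.
elim: l k => [|a l IH] k; first by rewrite /rev_roots !big_nil coef1 sub0n coef1; case: k.
rewrite rev_roots_cons big_cons mulrBl coefB mul_polyC coefZ coefXM /=.
have sz : size (\prod_(j <- l) ('X - j%:P)) = (size l).+1 by rewrite size_prod_XsubC.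
case: k => [|k]; rewrite !IH.
  by rewrite !subn0 /= [_`_(size l).+1]nth_default ?sz.
rewrite subSS ltnS; case: (ltngtP k (size l)) => [kl|kl|->].
- by rewrite subn_eq0 leqNgt kl /= -subnS.
- by rewrite mulr0 subr0.
by rewrite subnn.
Qed.

(** Induction on l: adjoining the root a replaces the left-hand side S_k by S_k - a S_(k-1),
    because the new powers of a telescope against the factor 1 - a X. *)
Lemma newton_identity (A : comNzRingType) (l : seq A) k :
  k%:R * (rev_roots l)`_k + \sum_(j < k) (rev_roots l)`_j * \sum_(a <- l) a ^+ (k - j) = 0.
Proof.
elim: l k => [|a l IH] k.
  rewrite big1 ?addr0 => [|j _]; last by rewrite big_nil mulr0.
  by rewrite /rev_roots big_nil coef1; case: k => [|k]; rewrite ?mul0r ?mulr0.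
case: k => [|k]; first by rewrite mul0r big_ord0 addr0.
have tele : \sum_(j < k.+1) (rev_roots (a :: l))`_j * a ^+ (k.+1 - j) =
    a * (rev_roots l)`_k.
  elim: k => [|k IHk].
    by rewrite big_ord_recl big_ord0 addr0 rev_roots_cons mulr0 subr0 subn0 expr1 mulrC.
  rewrite big_ord_recr /= subSn // subnn expr1 rev_roots_cons.
  rewrite (eq_bigr (fun j : 'I_k.+1 => a * ((rev_roots (a :: l))`_j * a ^+ (k.+1 - j)))).
    by rewrite -mulr_sumr IHk; ring.
  by move=> j _; rewrite subSn ?exprS; [ring | rewrite ltnW].
have := IH k; have := IH k.+1.
have -> : \sum_(j < k.+1) (rev_roots (a :: l))`_j * \sum_(b <- a :: l) b ^+ (k.+1 - j) =
  a * (rev_roots l)`_k + (\sum_(j < k.+1) (rev_roots l)`_j * (\sum_(b <- l) b ^+ (k.+1 - j))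
   - a * \sum_(j < k) (rev_roots l)`_j * (\sum_(b <- l) b ^+ (k - j))).
  rewrite -tele; under eq_bigr do rewrite big_cons mulrDr.
  rewrite big_split /=; congr (_ + _).
  under eq_bigr do rewrite rev_roots_cons mulrBl.
  rewrite sumrB; congr (_ - _); rewrite [in LHS]big_ord_recl /= mulr0 mul0r add0r mulr_sumr.
  by apply: eq_bigr => j _; rewrite subSS mulrA.
rewrite rev_roots_cons; set S1 := \sum_(j < k.+1) _; set S0 := \sum_(j < k) _.
move=> e1 e0; transitivity ((k.+1%:R * (rev_roots l)`_k.+1 + S1) -
    a * (k%:R * (rev_roots l)`_k + S0)); first by rewrite -[in LHS]natr1; ring.
by rewrite e1 e0 mulr0 subr0.
Qed.

(** The coefficients are listed from the leading one down, so that p_k is homogeneous of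
    degree k in the roots. *)
Definition rev_poly (A : nzRingType) n (p : nat -> A) : {poly A} :=
  \poly_(i < n.+1) p (n - i)%N.

Lemma rev_poly_roots (A : comNzRingType) n (p : nat -> A) (l : seq A) :
  (forall k, (n < k)%N -> p k = 0) -> p 0%N = 1 ->
  rev_poly n p = \prod_(a <- l) ('X - a%:P) ->
  size l = n /\ forall k, p k = (rev_roots l)`_k.
Proof.
move=> pn p0 ql; have sl : size l = n.
  have := congr1 (fun q : {poly A} => size q) ql.
  rewrite size_prod_XsubC size_poly_eq ?subnn ?p0 ?oner_eq0 //.
  by case.
split=> // k; rewrite coef_rev_roots sl -ql coef_poly ltnS leq_subr.
by case: ltnP => [/pn //|kn]; rewrite subKn.
Qed.

Lemma psum_roots (A : comNzRingType) n (p : nat -> A) (l : seq A) m :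
  (forall k, (n < k)%N -> p k = 0) -> p 0%N = 1 ->
  rev_poly n p = \prod_(a <- l) ('X - a%:P) ->
  psum n p m = \sum_(a <- l) a ^+ m.
Proof.
move=> pn p0 /(rev_poly_roots pn p0)[sl pl]; symmetry; move: m (leqnn m).
suff H M m : (m <= M)%N -> \sum_(a <- l) a ^+ m = psum n p m by move=> m; apply: H.
apply: (psum_uniq (h := fun m => \sum_(a <- l) a ^+ m)) => [|k /andP[k0 _]].
  under eq_bigr do rewrite expr0.
  by rewrite big_const_seq count_predT sl iter_addr_0.
rewrite -addrA addrCA -[RHS](newton_identity l k) -pl; congr (_ + _).
rewrite -(big_mkord xpredT (fun j => (rev_roots l)`_j * \sum_(a <- l) a ^+ (k - j))).
rewrite big_ltn // -pl p0 mul1r subn0; congr (_ + _).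
by apply: eq_bigr => j _; rewrite pl.
Qed.

(** * Real roots and averaged translates *)

(** If p lists the coefficients of q of degree n from the leading one down, this lists those
    of cos(sqrt(tau) d/dx) q, which is half the sum of q(x + i sqrt(tau)) and
    q(x - i sqrt(tau)). No square root occurs in the formula, hence it makes sense with tau a
    polynomial in y. *)
Definition cos_coef (A : comNzRingType) n (tau : A) (p : nat -> A) (j : nat) : A :=
  if (j <= n)%N then
    \sum_(k < n.+1 | (k.*2 <= j)%N)
      ((- tau) ^+ k * p (j - k.*2)%N) *+ 'C(k.*2 + (n - j), k.*2)
  else 0.

Lemma cos_coef_morph (A B : comNzRingType) (f : {rmorphism A -> B}) n tau p j :
  f (cos_coef n tau p j) = cos_coef n (f tau) (f \o p) j.
Proof.
rewrite /cos_coef; case: ifP => _; last exact: rmorph0.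
rewrite rmorph_sum; apply: eq_bigr => k _.
by rewrite rmorphMn rmorphM rmorphXn rmorphN.
Qed.

Lemma cos_coef0 (A : comNzRingType) n tau (p : nat -> A) :
  cos_coef n tau p 0 = p 0%N.
Proof.
rewrite /cos_coef /= (bigD1 ord0) //= big1 => [|[[|k] kn] /andP[]] //.
by rewrite addr0 bin0 expr0 mul1r.
Qed.

Lemma cos_coef_tau0 (A : comNzRingType) n (p : nat -> A) j :
  (j <= n)%N -> cos_coef n 0 p j = p j.
Proof.
move=> jn; rewrite /cos_coef jn (bigD1 ord0) //= big1 => [|[[|k] kn] /andP[_]] //=.
  by rewrite addr0 bin0 expr0 mul1r subn0.
by rewrite oppr0 expr0n mul0r mul0rn.
Qed.

Lemma eq_cos_coef (A : comNzRingType) n tau (p p' : nat -> A) : p =1 p' ->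
  cos_coef n tau p =1 cos_coef n tau p'.
Proof.
by move=> pp' j; rewrite /cos_coef; case: ifP => // _; apply: eq_bigr => k _; rewrite pp'.
Qed.

Lemma sum_double (A : nmodType) (F : nat -> A) m :
  \sum_(i < m.*2) F i = \sum_(k < m) (F k.*2 + F k.*2.+1).
Proof.
elim: m => [|m IH]; first by rewrite !big_ord0.
by rewrite doubleS !big_ord_recr /= IH addrA.
Qed.

(** In the sum of the two Taylor expansions at x the odd terms cancel. *)
Lemma cos_coefE (A : comNzRingType) n (tau h x : A) (p : nat -> A) :
  h ^+ 2 = - tau ->
  (rev_poly n p).[x + h] + (rev_poly n p).[x - h] =
  2%:R * (rev_poly n (cos_coef n tau p)).[x].
Proof.
move=> h2; set q := rev_poly n p.
have qE : rev_poly n (cos_coef n tau p) = \sum_(k < n.+1) (- tau) ^+ k *: q^`N(k.*2).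
  apply/polyP=> i; rewrite coef_poly coef_sum; case: ltnP => [|ni].
    rewrite ltnS => i_n; rewrite /cos_coef leq_subr subKn //.
    rewrite big_mkcond; apply: eq_bigr => k _; rewrite coefZ coef_nderivn coef_poly.
    have -> : (k.*2 + i < n.+1)%N = (k.*2 <= n - i)%N by lia.
    by case: ifP => ki; rewrite ?mul0rn ?mulr0 // mulrnAr -subnDA [(i + _)%N]addnC.
  rewrite big1 // => k _; rewrite coefZ coef_nderivn coef_poly ltnS leqNgt.
  by rewrite (leq_trans ni) ?leq_addl // mul0rn mulr0.
have sq : (size q <= (n.+1).*2)%N by apply: leq_trans (size_poly _ _) _; lia.
rewrite !(nderiv_taylor_wide (mulrC _ _) sq) -big_split (sum_double (fun i =>
  q^`N(i).[x] * h ^+ i + q^`N(i).[x] * (- h) ^+ i)) /= qE horner_sum mulr_sumr.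
apply: eq_bigr => k _; rewrite hornerZ !exprS -!muln2 ![(k * 2)%N]mulnC !exprM.
by rewrite sqrrN h2; ring.
Qed.

Section RealRoots.
Variable C : numClosedFieldType.
Implicit Types (l : seq C) (f : {poly C}).

Definition real_poly f := map_poly Num.conj f = f.

(** Hermite's criterion: for a non-real root b there is a real polynomial with value i at b,
    -i at the conjugate of b and 0 at all other roots, and its sum of squares is negative. *)
Lemma real_roots_of_psd l : perm_eq (map Num.conj l) l ->
  (forall f, (size f <= size l)%N -> real_poly f -> 0 <= \sum_(a <- l) f.[a] ^+ 2) ->
  all (fun a => a \is Num.real) l.
Proof.
move=> lc pos; apply/allP => b bl; apply/negPn/negP => bnR.
have bcl : b^* \in l by rewrite -(perm_mem lc) map_f.
have bb : b^* != b by apply: contraNneq bnR => /CrealP.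
pose g0 := \prod_(a <- rem b (undup l)) ('X - a%:P).
have g0b : g0.[b] != 0.
  rewrite -[_ == 0]/(root _ b) root_prod_XsubC.
  by rewrite mem_rem_uniq ?undup_uniq // inE eqxx.
have g00 a : a \in l -> a != b -> g0.[a] = 0.
  move=> al ab; apply/eqP; rewrite -[_ == 0]/(root _ a) root_prod_XsubC.
  by rewrite mem_rem_uniq ?undup_uniq // inE ab mem_undup.
pose g := ('i / g0.[b]) *: g0; pose f := g + map_poly Num.conj g.
have ga a : a \in l -> g.[a] = if a == b then 'i else 0.
  by move=> al; rewrite hornerZ; case: eqP => [->|/eqP/g00->]; rewrite ?divfK ?mulr0.
have fR : real_poly f.
  rewrite /real_poly /f rmorphD /= addrC; congr (_ + _).
  by apply/polyP => i; rewrite !coef_map /= conjCK.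
have sg : (size g <= size l)%N.
  apply: leq_trans (size_scale_leq _ _) _; rewrite size_prod_XsubC size_rem ?mem_undup //.
  rewrite prednK ?size_undup //.
  by case: (undup l) (mem_undup l b) => //; rewrite bl.
have sf : (size f <= size l)%N.
  by apply: leq_trans (size_polyD _ _) _; rewrite size_map_poly maxnn.
have fa a : a \in l -> f.[a] ^+ 2 = - ((a == b) || (a == b^*))%:R.
  move=> al; have acl : a^* \in l by rewrite -(perm_mem lc) map_f.
  have -> : f.[a] = g.[a] + (g.[a^*])^*.
    by rewrite hornerD horner_conj_poly.
  rewrite !ga // -{2}[b]conjCK (inj_eq (inv_inj conjCK)).
  case: eqP => [->|_]; first by rewrite eq_sym (negbTE bb) rmorph0 addr0 sqrCi.
  by case: eqP => _; rewrite ?conjCi ?rmorph0 add0r ?sqrrN ?sqrCi ?expr0n ?oppr0.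
have := pos f sf fR; apply/negP; rewrite -real_ltNge ?real0 //; last first.
  rewrite big_seq rpred_sum // => a /fa ->; by rewrite rpredN realn.
rewrite (big_rem b) //= fa // eqxx /=; apply: ltr_wnDr; last by rewrite oppr_lt0 ltr01.
rewrite big_seq sumr_le0 // => a /mem_rem /fa ->; by rewrite oppr_le0 ler0n.
Qed.

Lemma deriv_prod_XsubC l z : z \notin l ->
  (\prod_(a <- l) ('X - a%:P))^`().[z] =
  (\prod_(a <- l) ('X - a%:P)).[z] * \sum_(a <- l) (z - a)^-1.
Proof.
elim: l => [|a l IH]; first by rewrite !big_nil derivC horner0 mulr0.
rewrite inE negb_or => /andP[za zl]; rewrite !big_cons derivM derivXsubC mul1r.
rewrite hornerD !hornerM !hornerXsubC IH //; set P := (\prod_(a <- l) _).[z].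
have : z - a != 0 by rewrite subr_eq0.
by move=> zan0; rewrite mulrDr -[_ * P * (z - a)^-1]mulrAC divff // mul1r mulrA.
Qed.

Lemma uniq_simple_roots l :
  {in l, forall z, (\prod_(a <- l) ('X - a%:P))^`().[z] != 0} -> uniq l.
Proof.
elim: l => //= a l IH simple.
have D z : (\prod_(b <- a :: l) ('X - b%:P))^`().[z] =
    (\prod_(b <- l) ('X - b%:P)).[z] + (z - a) * (\prod_(b <- l) ('X - b%:P))^`().[z].
  by rewrite big_cons derivM derivXsubC mul1r hornerD hornerM hornerXsubC.
apply/andP; split.
  have := simple a (mem_head _ _); rewrite D subrr mul0r addr0.
  by rewrite -[_ == 0]/(root _ a) root_prod_XsubC.
apply: IH => z zl; have := simple z; rewrite inE zl orbT => /(_ isT).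
have /rootP zr : root (\prod_(b <- l) ('X - b%:P)) z by rewrite root_prod_XsubC.
by rewrite D zr add0r mulf_eq0 negb_or => /andP[].
Qed.

Section Translates.
Variables (l : seq C) (d : C) (G : {poly C}).
Hypothesis lR : {in l, forall a, a \is Num.real}.
Hypothesis ln0 : l != [::].
Hypothesis d0 : 0 < d.
Let P1 := \prod_(a <- [seq a - 'i * d | a <- l]) ('X - a%:P).
Let P2 := \prod_(a <- [seq a + 'i * d | a <- l]) ('X - a%:P).
Hypothesis GE : 2%:R *: G = P1 + P2.

Let dR : d \is Num.real. Proof. exact: gtr0_real. Qed.

Let ImD z a (s : C) : a \is Num.real -> s \is Num.real ->
  'Im (z - (a + 'i * s)) = 'Im z - s.
Proof.
move=> aR sR; rewrite !raddfB raddfD /= (Creal_ImP _ aR) add0r; congr (_ - _).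
by rewrite -[X in 'Im X]add0r Im_rect ?real0.
Qed.

Let ReD z a (s : C) : a \is Num.real -> s \is Num.real ->
  'Re (z - (a + 'i * s)) = 'Re z - a.
Proof.
move=> aR sR; rewrite !raddfB raddfD /= (Creal_ReP _ aR).
by rewrite -['i * s]add0r Re_rect ?real0 // addr0.
Qed.

Let norm_lt (z a s t : C) : a \is Num.real -> s \is Num.real -> t \is Num.real ->
  ('Im z - s) ^+ 2 < ('Im z - t) ^+ 2 -> `|z - (a + 'i * s)| < `|z - (a + 'i * t)|.
Proof.
move=> aR sR tR lt_st; rewrite -(@ltr_pXn2r _ 2) ?nnegrE //.
by rewrite !normC2_Re_Im !ImD // !ReD // ltrD2l.
Qed.

(** A point off the real axis is closer to one of a + id and a - id than to the other, the
    same one for every root a, so the two products differ in modulus and cannot cancel. *)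
Lemma translate_roots_real z : G.[z] = 0 -> z \is Num.real.
Proof.
move=> Gz; apply/Creal_ImP.
have e : P1.[z] = - P2.[z].
  by apply/eqP; rewrite -addr_eq0 -hornerD -GE hornerZ Gz mulr0.
have {e} : `|P1.[z]| = `|P2.[z]| by rewrite e normrN.
rewrite !horner_prod !normr_prod !big_map => e.
have cmp (s t : C) : s \is Num.real -> t \is Num.real ->
    ('Im z - s) ^+ 2 < ('Im z - t) ^+ 2 ->
    \prod_(a <- l) `|('X - (a + 'i * s)%:P).[z]| <
    \prod_(a <- l) `|('X - (a + 'i * t)%:P).[z]|.
  move=> sR tR st; rewrite big_seq [ltRHS]big_seq; apply: ltr_prod.
    by case: (l) ln0 => // a l' _; rewrite /= mem_head.
  by move=> a /lR aR; rewrite !hornerXsubC normr_ge0 norm_lt.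
have ndR : - d \is Num.real by rewrite rpredN.
have e' : \prod_(a <- l) `|('X - (a + 'i * - d)%:P).[z]| =
    \prod_(a <- l) `|('X - (a + 'i * d)%:P).[z]|.
  by rewrite -e; apply: eq_bigr => a _; rewrite mulrN.
have IR := Creal_Im z.
have sqd : ('Im z + d) ^+ 2 - ('Im z - d) ^+ 2 = 'Im z * (d *+ 4) by ring.
case: (real_ltgt0P IR) => // z0; exfalso.
- have := cmp _ _ dR ndR; rewrite e' ltxx opprK -subr_gt0 sqd.
  by rewrite pmulr_rgt0 // pmulrn_lgt0 // d0 => /(_ isT).
have := cmp _ _ ndR dR; rewrite e' ltxx opprK -subr_lt0 sqd.
by rewrite nmulr_rlt0 // pmulrn_lgt0 // d0 => /(_ isT).
Qed.

(** At a real zero of G the two products are w and -w. If the derivative vanished too, the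
    logarithmic derivative of the first product would be real, whereas all its terms have
    negative imaginary part. *)
Lemma translate_roots_simple z : G.[z] = 0 -> G^`().[z] != 0.
Proof.
move=> Gz; have zR := translate_roots_real Gz.
have zc := conj_Creal zR.
pose w := P1.[z]; pose S := \sum_(a <- l) (z - (a - 'i * d))^-1.
have n1 : z \notin [seq a - 'i * d | a <- l].
  apply/mapP => -[a /lR aR zE].
  have ndR : - d \is Num.real by rewrite rpredN.
  have := ImD z aR ndR; rewrite mulrN -zE subrr raddf0 (Creal_ImP _ zR).
  by rewrite sub0r opprK => /esym/eqP; rewrite gt_eqF.
have P2E : P2 = map_poly Num.conj P1.
  rewrite /P1 /P2 map_prod_XsubC !big_map; apply: eq_big_seq => a /lR aR.
  by rewrite rmorphB rmorphM /= conjCi !conj_Creal // mulNr opprK.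
have P2z : P2.[z] = w^* by rewrite P2E horner_conj_poly zc.
have P1' : P1^`().[z] = w * S by rewrite deriv_prod_XsubC //; congr (_ * _); rewrite big_map.
have P2' : P2^`().[z] = (w * S)^*.
  by rewrite P2E deriv_map horner_conj_poly zc P1'.
have w0 : w != 0 by rewrite -[_ == 0]/(root _ z) root_prod_XsubC.
have wc : w^* = - w.
  by apply/eqP; rewrite -addr_eq0 addrC -P2z -hornerD -GE hornerZ Gz mulr0.
apply/negP => /eqP G'z.
have : w * (S - S^*) = 0.
  have := congr1 (fun f : {poly C} => f^`().[z]) GE.
  rewrite /= derivZ hornerZ G'z mulr0 derivD hornerD P1' P2' rmorphM /= wc => e.
  by rewrite mulrBr e mulNr.
move/eqP; rewrite mulf_eq0 (negbTE w0) /= subr_eq0 eq_sym.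
move/eqP/CrealP/Creal_ImP; rewrite /S raddf_sum /= => ImS.
suff : \sum_(a <- l) 'Im (z - (a - 'i * d))^-1 < 0 by rewrite ImS ltxx.
have term a : a \in l -> 'Im (z - (a - 'i * d))^-1 < 0.
  move=> al; have zan0 : z - (a - 'i * d) != 0.
    by rewrite subr_eq0; apply: contraNneq n1 => ->; exact: (map_f (fun b => b - 'i * d)).
  rewrite invC_norm ImMl ?rpredV ?rpredX ?normr_real // Im_conj.
  rewrite -[- ('i * d)]mulrN ImD ?rpredN ?(lR al) // (Creal_ImP _ zR) sub0r opprK.
  by rewrite pmulr_rlt0 ?oppr_lt0 // invr_gt0 exprn_gt0 // normr_gt0 mulrN.
case: (l) ln0 term => // a l' _ term; rewrite big_cons.
rewrite ltr_wnDr ?term ?mem_head // big_seq sumr_le0 // => b bl.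
by rewrite ltW // term // inE bl orbT.
Qed.

End Translates.

End RealRoots.

(** * Perturbation to simple real roots *)

Lemma poly_eq_nat (C : numDomainType) (f g : {poly C}) :
  (forall k : nat, f.[k%:R] = g.[k%:R]) -> f = g.
Proof.
move=> fg; apply/eqP; rewrite -subr_eq0; apply/negPn/negP => /exists_nat_nonroot[k].
by rewrite hornerD hornerN fg subrr eqxx.
Qed.

Section CosRoots.
Variable C : numClosedFieldType.

Lemma rev_poly_monic n (p : nat -> C) : p 0%N = 1 -> rev_poly n p \is monic.
Proof.
move=> p0; rewrite monicE lead_coefE size_poly_eq ?subnn ?p0 ?oner_eq0 //.
by rewrite coef_poly ltnSn subnn p0.
Qed.

Lemma rev_poly_split n (p : nat -> C) : p 0%N = 1 ->
  exists l, rev_poly n p = \prod_(a <- l) ('X - a%:P).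
Proof.
move=> p0; have [l lE] := closed_field_poly_normal (rev_poly n p); exists l.
by rewrite lE (monicP (rev_poly_monic n p0)) scale1r.
Qed.

(** Positivity makes the original roots real; averaging the two imaginary translates keeps
    the roots real and makes them simple. *)
Lemma cos_coef_real_roots n (p : nat -> C) tau : (0 < n)%N ->
  p 0%N = 1 -> (forall k, (n < k)%N -> p k = 0) -> (forall k, p k \is Num.real) ->
  (forall v : nat -> C, (forall k, v k \is Num.real) ->
    0 <= \sum_(r < n) \sum_(s < n) v r * v s * psum n p (r + s)) ->
  0 < tau ->
  exists l, [/\ size l = n, uniq l, {in l, forall a, a \is Num.real} &
    rev_poly n (cos_coef n tau p) = \prod_(a <- l) ('X - a%:P)].
Proof.
move=> n0 p0 pn pR psd tau0.
have [l lE] := rev_poly_split n p0.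
have [sl _] := rev_poly_roots pn p0 lE.
have lc : perm_eq (map Num.conj l) l.
  apply: prod_XsubC_eq; rewrite big_map -map_prod_XsubC -lE.
  apply/polyP => i; rewrite coef_map !coef_poly.
  by case: ifP => _ /=; rewrite ?rmorph0 ?conj_Creal.
have /allP lR : all (fun a => a \is Num.real) l.
  apply: real_roots_of_psd lc _ => f sf fR.
  have fkR k : f`_k \is Num.real by apply/CrealP; rewrite -{2}fR coef_map.
  apply: le_trans (psd _ fkR) _; rewrite le_eqVlt; apply/orP; left; apply/eqP.
  under eq_bigr => r _ do under eq_bigr => s _ do
    rewrite (psum_roots _ pn p0 lE) mulr_sumr.
  under eq_bigr => r _ do rewrite exchange_big.
  rewrite exchange_big /=; apply: eq_bigr => a _.
  rewrite (horner_coef_wide _ (n := n)) -?sl // expr2 mulr_suml sl.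
  apply: eq_bigr => r _; rewrite mulr_sumr; apply: eq_bigr => s _.
  by rewrite exprD; ring.
pose d := sqrtC tau; have d0 : 0 < d by rewrite sqrtC_gt0.
have ln0 : l != [::] by rewrite -size_eq0 sl -lt0n.
set G := rev_poly n (cos_coef n tau p).
have GE : 2%:R *: G = \prod_(a <- [seq a - 'i * d | a <- l]) ('X - a%:P) +
    \prod_(a <- [seq a + 'i * d | a <- l]) ('X - a%:P).
  apply: poly_eq_nat => k; rewrite hornerZ hornerD -(@cos_coefE _ _ _ ('i * d)); last first.
    by rewrite exprMn sqrCi sqrtCK mulN1r.
  rewrite lE !horner_prod !big_map; congr (_ + _); apply: eq_bigr => a _;
    by rewrite !hornerXsubC; ring.
have Gp0 : cos_coef n tau p 0 = 1 by rewrite cos_coef0.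
have [l' l'E] := rev_poly_split n Gp0.
have l'r z : z \in l' -> G.[z] = 0.
  by move=> zl'; apply/rootP; rewrite /G l'E root_prod_XsubC.
exists l'; split=> //.
- have := congr1 (fun q : {poly C} => size q) l'E; rewrite size_prod_XsubC.
  by rewrite size_poly_eq ?subnn ?Gp0 ?oner_eq0 // => -[].
- apply: uniq_simple_roots => z /l'r; rewrite -l'E.
  exact: (translate_roots_simple lR ln0 d0 GE).
by move=> z /l'r; apply: (translate_roots_real lR ln0 d0 GE).
Qed.

(** The form is the sum of the |f(a)|^2 where f has coefficients v, and f is too short to
    vanish at n points. *)
Lemma power_hankel_pos n l (v : 'cV[C]_n) :
  size l = n -> uniq l -> {in l, forall a, a \is Num.real} -> v != 0 ->
  0 < (v^t* *m (\matrix_(r, s) \sum_(a <- l) a ^+ (r + s)) *m v) 0 0.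
Proof.
move=> sl ul lR vn0; pose f := \poly_(i < n) (if insub i is Some j then v j 0 else 0).
have fE a : f.[a] = \sum_(r < n) v r 0 * a ^+ r.
  by rewrite horner_poly; apply: eq_bigr => r _; rewrite valK.
have -> : (v^t* *m (\matrix_(r, s) \sum_(a <- l) a ^+ (r + s)) *m v) 0 0 =
    \sum_(a <- l) `|f.[a]| ^+ 2.
  rewrite mxE; under eq_bigr do rewrite mxE mulr_suml.
  under eq_bigr => s _ do under eq_bigr => r _ do rewrite !mxE mulr_sumr mulr_suml.
  under eq_bigr => s _ do rewrite exchange_big /=.
  rewrite exchange_big big_seq [RHS]big_seq; apply: eq_bigr => a /lR aR.
  rewrite normCK fE rmorph_sum mulr_suml; apply: eq_bigr => s _.
  rewrite mulr_sumr; apply: eq_bigr => r _.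
  rewrite rmorphM rmorphXn /= (conj_Creal aR) exprD; ring.
have fn0 : f != 0.
  apply: contraNneq vn0 => f0; apply/eqP/colP=> i; rewrite mxE.
  by have := congr1 (fun q : {poly C} => q`_i) f0; rewrite coef_poly ltn_ord valK coef0.
have : ~~ all (root f) l.
  apply/negP => rs; have := max_poly_roots fn0 rs ul.
  by rewrite sl ltnNge size_poly.
case/allPn => a al fa; rewrite (big_rem a) //=; apply: ltr_wpDr.
  by apply: sumr_ge0 => b _; rewrite exprn_ge0.
by rewrite exprn_gt0 // normr_gt0.
Qed.

End CosRoots.

(** * Leading coefficients *)

(** The number c, possibly 0, is the value at infinity of f seen as a form of degree k. *)
Definition has_top (R : nzRingType) (k : nat) (f : {poly R}) (c : R) :=
  (size f <= k.+1)%N /\ f`_k = c.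

Section HasTop.
Variable R : comNzRingType.
Implicit Types (f g : {poly R}) (c d : R).

Lemma has_topM a b f g c d :
  has_top a f c -> has_top b g d -> has_top (a + b) (f * g) (c * d).
Proof.
move=> [sf <-] [sg <-]; split; first by apply: leq_trans (size_polyMleq _ _) _; lia.
rewrite coefM; have ab : (a < (a + b).+1)%N by rewrite ltnS leq_addr.
rewrite (bigD1 (Ordinal ab)) //= addKn big1 ?addr0 // => i ia.
have [ilt|ige] := ltnP a i; first by rewrite [f`_i]nth_default ?mul0r // (leq_trans sf).
have {ia} ilt : (i < a)%N.
  by rewrite ltn_neqAle ige andbT; apply: contraNneq ia => ia; apply/eqP/val_inj.
by rewrite [g`_(_)]nth_default ?mulr0 //; apply: leq_trans sg _; lia.
Qed.

Lemma has_topD k f g c d : has_top k f c -> has_top k g d -> has_top k (f + g) (c + d).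
Proof.
move=> [sf <-] [sg <-]; split; last by rewrite coefD.
by apply: leq_trans (size_polyD _ _) _; rewrite geq_max sf.
Qed.

Lemma has_topN k f c : has_top k f c -> has_top k (- f) (- c).
Proof. by move=> [sf <-]; split; rewrite ?size_polyN ?coefN. Qed.

Lemma has_topMn k f c m : has_top k f c -> has_top k (f *+ m) (c *+ m).
Proof.
move=> [sf <-]; split; last by rewrite coefMn.
by rewrite -scaler_nat; apply: leq_trans (size_scale_leq _ _) _.
Qed.

Lemma has_topX k f c m : has_top k f c -> has_top (m * k) (f ^+ m) (c ^+ m).
Proof.
move=> fc; elim: m => [|m IH]; last by rewrite mulSn !exprS; apply: has_topM.
by rewrite !expr0 mul0n; split; rewrite ?size_poly1 ?coef1.
Qed.

Lemma has_top0 k : has_top k (0 : {poly R}) 0.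
Proof. by split; rewrite ?size_poly0 ?coef0. Qed.

Lemma has_top_sum k I (r : seq I) (P : pred I) (F : I -> {poly R}) (G : I -> R) :
  (forall i, P i -> has_top k (F i) (G i)) ->
  has_top k (\sum_(i <- r | P i) F i) (\sum_(i <- r | P i) G i).
Proof.
move=> FG; apply: big_rec2 => [|i c f Pi fc]; first exact: has_top0.
by apply: has_topD (FG i Pi) _.
Qed.

Lemma has_top_prod (I : finType) (a : I -> nat) (F : I -> {poly R}) (G : I -> R) :
  (forall i, has_top (a i) (F i) (G i)) ->
  has_top (\sum_i a i) (\prod_i F i) (\prod_i G i).
Proof.
move=> FG; elim/big_rec3: _ => [|i c f k _ fc].
  by split; rewrite ?size_poly1 ?coef1.
exact: has_topM (FG i) fc.
Qed.

Lemma has_top_det n (A : 'M[{poly R}]_n) (B : 'M[R]_n) (a b : 'I_n -> nat) :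
  (forall i j, has_top (a i + b j) (A i j) (B i j)) ->
  has_top (\sum_i a i + \sum_j b j) (\det A) (\det B).
Proof.
move=> AB; apply: has_top_sum => s _; rewrite (reindex_inj (@perm_inj _ s) (F := b)).
rewrite -big_split /=; have := has_top_prod (fun i => AB i (s i)).
rewrite !(mulr_sign (odd_perm s)); case: odd_perm => //.
exact: has_topN.
Qed.

Lemma has_top_psum n (p : nat -> {poly R}) (t : nat -> R) m :
  (forall k, has_top k (p k) (t k)) -> has_top m (psum n p m) (psum n t m).
Proof.
move=> pt; elim/ltn_ind: m => -[_|m IH].
  by rewrite /= -polyC_natr; split; rewrite ?size_polyC ?coefC //; case: eqP.
rewrite !psumE //; apply/has_topN/has_topD; first by rewrite !mulr_natl; apply: has_topMn.
rewrite !big_seq; apply: has_top_sum => k; rewrite mem_index_iota => /andP[k0 km].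
rewrite -{1}(subnKC (ltnW km)); apply: has_topM; first exact: pt.
by apply: IH; lia.
Qed.

Lemma has_top_cos n tau u (p : nat -> {poly R}) (t : nat -> R) m :
  has_top 2 tau u ->
  (forall k, has_top k (p k) (t k)) -> has_top m (cos_coef n tau p m) (cos_coef n u t m).
Proof.
move=> tu pt; rewrite /cos_coef; case: ifP => _; last exact: has_top0.
apply: has_top_sum => k km; apply: has_topMn.
rewrite -{1}(subnKC km) -muln2; apply: has_topM => //.
exact/has_topX/has_topN.
Qed.

End HasTop.

(** Power sums satisfy the linear recurrence whose characteristic polynomial is rev_poly n p.
    The term p_n appears with the weight n = psum n p 0 when r = 0. *)
Lemma psum_rec (A : comNzRingType) n (p : nat -> A) r : (0 < n)%N ->
  (forall k, (n < k)%N -> p k = 0) ->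
  psum n p (r + n) = - \sum_(i < n) psum n p (r + i) * p (n - i)%N.
Proof.
move=> n0 pn; rewrite psumE ?addn_gt0 ?n0 ?orbT //; congr (- _).
rewrite -(big_mkord xpredT (fun i => psum n p (r + i) * p (n - i)%N)) [RHS]big_nat_rev /=.
have -> : \sum_(0 <= i < n) psum n p (r + (0 + n - i.+1)) * p (n - (0 + n - i.+1))%N =
    \sum_(1 <= k < n.+1) p k * psum n p (r + n - k).
  rewrite big_add1 /=; apply: eq_big_nat => i /andP[_ i_n].
  by rewrite mulrC; congr (p _ * psum n p _); lia.
case: r => [|r].
  by rewrite !add0n big_nat_recr //= subnn /= addrC mulrC.
rewrite pn ?mulr0 ?add0r; last by lia.
rewrite (@big_cat_nat _ _ _ n.+1) //=; last by lia.
rewrite [X in _ + X]big_nat_cond [X in _ + X]big1 ?addr0 // => k /andP[/andP[nk _] _].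
by rewrite pn ?mul0r.
Qed.

(** * Pencils for the perturbed polynomials *)

Local Open Scope complex_scope.

Section Companion.
Variables (A : comNzRingType) (n : nat) (p : nat -> A).

(** The columns of multiplication by x in the basis 1, x, ..., x^(n-1) modulo rev_poly n p. *)
Definition companion_col : 'M[A]_n :=
  \matrix_(i, j) if j.+1 == n then - p (n - i)%N else (i == j.+1 :> nat)%:R.

Lemma mul_companion m (w : 'M[A]_(m, n)) i j :
  (w *m companion_col) i j =
  if insub j.+1 is Some k then w i k else - \sum_k w i k * p (n - k)%N.
Proof.
rewrite mxE; case: insubP => [k _ kj|].
  rewrite (bigD1 k) //= big1 ?addr0 => [|l lk]; rewrite mxE -kj ltn_eqF ?ltn_ord //.
    by rewrite eqxx mulr1.
  by rewrite val_eqE (negbTE lk) mulr0.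
rewrite -leqNgt => jn.
rewrite -sumrN; apply: eq_bigr => k _; rewrite mxE.
have -> : (j.+1 == n) by rewrite eqn_leq ltn_ord.
by rewrite mulrN.
Qed.
End Companion.

Definition hankel_psum (A : comNzRingType) n (p : nat -> A) : 'M[A]_n :=
  \matrix_(r, s) psum n p (r + s).

(** Multiplication by x shifts the index of every power sum; the result is symmetric, which is
    the self-adjointness required by hermitian_pencil. *)
Lemma hankel_companion (A : comNzRingType) n (p : nat -> A) :
  (forall k, (n < k)%N -> p k = 0) ->
  hankel_psum n p *m companion_col n p = \matrix_(r, s) psum n p (r + s).+1.
Proof.
move=> pn; apply/matrixP=> r s; rewrite mul_companion [RHS]mxE.
case: insubP => [k _ /= kE|]; first by rewrite mxE kE addnS.
rewrite -leqNgt => ns; have sE : s.+1 = n by apply/eqP; rewrite eqn_leq ltn_ord.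
rewrite -addnS sE psum_rec //; last by apply: leq_trans (ltn_ord r).
by congr (- _); apply: eq_bigr => k _; rewrite mxE.
Qed.

Lemma map_companion (A B : comNzRingType) (f : {rmorphism A -> B}) n (p : nat -> A) :
  map_mx f (companion_col n p) = companion_col n (f \o p).
Proof.
by apply/matrixP=> i j; rewrite !mxE; case: eqP => _; rewrite ?rmorphN ?rmorph_nat.
Qed.

Lemma eq_companion (A : comNzRingType) n (p p' : nat -> A) : p =1 p' ->
  companion_col n p = companion_col n p'.
Proof. by move=> pp'; apply/matrixP=> i j; rewrite !mxE pp'. Qed.

Lemma map_hankel_psum (A B : comNzRingType) (f : {rmorphism A -> B}) n (p : nat -> A) :
  map_mx f (hankel_psum n p) = hankel_psum n (f \o p).
Proof. by apply/matrixP=> i j; rewrite !mxE psum_morph. Qed.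

Lemma trace_diag_exp (A : pzRingType) n (a : 'rV[A]_n) m :
  \tr (diag_mx a ^+ m) = \sum_i a 0 i ^+ m.
Proof.
have -> : diag_mx a ^+ m = diag_mx (\row_i (a 0 i ^+ m)).
  elim: m => [|m IH]; first by apply/matrixP=> i j; rewrite !mxE expr0.
  rewrite exprS IH -mulmxE mulmx_diag; congr diag_mx; apply/rowP=> i.
  by rewrite !mxE exprS.
by rewrite mxtrace_diag; apply: eq_bigr => i _; rewrite mxE.
Qed.

(** The Vandermonde matrix of the simple roots diagonalizes the companion matrix. *)
Lemma trace_companion (C : fieldType) n (p : nat -> C) l m :
  (forall k, (n < k)%N -> p k = 0) -> p 0%N = 1 ->
  rev_poly n p = \prod_(a <- l) ('X - a%:P) -> uniq l ->
  \tr (companion_col n p ^+ m) = psum n p m.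
Proof.
move=> pn p0 lE ul; have [sl _] := rev_poly_roots pn p0 lE.
rewrite (psum_roots m pn p0 lE).
pose a : 'rV[C]_n := \row_i l`_i.
have dV : \det (Vandermonde n a)^T != 0.
  rewrite det_tr det_Vandermonde; apply/prodf_neq0 => i _; apply/prodf_neq0 => j ij.
  by rewrite !mxE subr_eq0 nth_uniq ?sl // gtn_eqF.
rewrite -(similar_trace (M := diag_mx a) m dV).
  rewrite trace_diag_exp (big_nth 0) big_mkord sl.
  by apply: eq_bigr => i _; rewrite mxE.
apply/matrixP=> i j; rewrite mul_diag_mx mul_companion !mxE.
case: insubP => [k _ kj|]; first by rewrite !mxE kj exprS.
rewrite -leqNgt => jn; have jE : j.+1 = n by apply/eqP; rewrite eqn_leq ltn_ord.
rewrite -exprS jE.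
have : root (rev_poly n p) l`_i by rewrite lE root_prod_XsubC mem_nth ?sl.
move/rootP; rewrite horner_poly big_ord_recr /= subnn p0 mul1r addrC => /eqP.
rewrite addr_eq0 => /eqP ->; congr (- _); apply: eq_bigr => k _.
by rewrite !mxE mulrC.
Qed.

Section Strict.
Variable R : rcfType.
Local Notation toC := (real_complex R).

Lemma real_toC (x : R) : x%:C \is Num.real.
Proof. by apply/complex_realP; exists x. Qed.

Definition hankel_psd n (q : nat -> R) :=
  forall v : nat -> R, 0 <= \sum_(r < n) \sum_(s < n) v r * v s * psum n q (r + s).

Lemma cos_coef_split n (q : nat -> R) t : (0 < n)%N ->
  q 0%N = 1 -> (forall k, (n < k)%N -> q k = 0) -> hankel_psd n q -> 0 < t ->
  exists l, [/\ size l = n, uniq l, {in l, forall a, a \is Num.real} &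
    rev_poly n (toC \o cos_coef n t q) = \prod_(a <- l) ('X - a%:P)].
Proof.
move=> n0 q0 qn psd t0.
have [|k kn|k|v vR||l [sl ul lR lE]] := @cos_coef_real_roots R[i] n (toC \o q) t%:C n0.
- by rewrite /= q0.
- by rewrite /= qn.
- exact: real_toC.
- have vE k : v k = (complex.Re (v k))%:C by rewrite RRe_real.
  rewrite (_ : \sum_(r < n) _ = (\sum_(r < n) \sum_(s < n)
      complex.Re (v r) * complex.Re (v s) * psum n q (r + s))%:C).
    by rewrite ler0c; apply: psd (fun k => complex.Re (v k)).
  rewrite rmorph_sum; apply: eq_bigr => r _; rewrite rmorph_sum; apply: eq_bigr => s _.
  by rewrite !rmorphM /= -!vE psum_morph.
- by rewrite ltcR.
exists l; split=> //; rewrite -lE; apply/polyP=> i; rewrite !coef_poly.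
by case: ifP => // _; rewrite /= cos_coef_morph.
Qed.

Lemma cos_hankel_pos n (q : nat -> R) t (v : 'cV[R[i]]_n) : (0 < n)%N ->
  q 0%N = 1 -> (forall k, (n < k)%N -> q k = 0) -> hankel_psd n q -> 0 < t ->
  v != 0 -> 0 < (v^t* *m hankel_psum n (toC \o cos_coef n t q) *m v) 0 0.
Proof.
move=> n0 q0 qn psd t0 vn0; have [l [sl ul lR lE]] := cos_coef_split n0 q0 qn psd t0.
have := power_hankel_pos sl ul lR vn0; congr (0 < (_ *m _ *m _) _ _).
apply/matrixP=> r s; rewrite !mxE (psum_roots _ _ _ lE) //= ?cos_coef0 ?q0 //.
by move=> k nk; rewrite /cos_coef leqNgt nk.
Qed.

(** Positivity passes to y = infinity: with v_r replaced by v_r / y^r the form at y tends to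
    the form of the top coefficients. After multiplication by y^N this is a statement on the
    leading coefficient of the polynomial F. *)
Lemma psd_top n (p : nat -> {poly R}) (t : nat -> R) : (0 < n)%N ->
  (forall k, has_top k (p k) (t k)) ->
  (forall y, hankel_psd n (fun k => (p k).[y])) -> hankel_psd n t.
Proof.
move=> n0 pt psd v; 
pose N := (n.-1 + n.-1)%N.
pose F : {poly R} := \sum_(r < n) \sum_(s < n)
  (v r * v s) *: ('X^(N - (r + s)) * psum n p (r + s)).
have FN : has_top N F (\sum_(r < n) \sum_(s < n) v r * v s * psum n t (r + s)).
  apply: has_top_sum => r _; apply: has_top_sum => s _.
  have rsN : (r + s <= N)%N by rewrite /N; have := ltn_ord r; have := ltn_ord s; lia.
  rewrite -[(v r * v s) *: _]mul_polyC -[X in has_top X](add0n N) -[psum n t _]mul1r.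
  apply: has_topM; first by split; rewrite ?size_polyC ?coefC //; case: eqP.
  rewrite -{1}(subnK rsN); apply: has_topM; last exact: has_top_psum.
  by split; rewrite ?size_polyXn ?coefXn ?eqxx.
have Fpos y : 0 < y -> 0 <= F.[y].
  move=> y0; have := psd y (fun k => v k / y ^+ k); set S := \sum_(r < n) _ => S0.
  have -> : F.[y] = y ^+ N * S.
    rewrite horner_sum mulr_sumr; apply: eq_bigr => r _.
    rewrite horner_sum mulr_sumr; apply: eq_bigr => s _.
    rewrite hornerZ hornerM hornerXn -[(psum n p _).[y]]/(horner_eval y _) psum_morph.
    have rsN : (r + s <= N)%N by rewrite /N; have := ltn_ord r; have := ltn_ord s; lia.
    rewrite -{2}(subnK rsN) !exprD /=.
    have yr : y ^+ r != 0 by rewrite expf_neq0 ?gt_eqF.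
    have ys : y ^+ s != 0 by rewrite expf_neq0 ?gt_eqF.
    by rewrite (@eq_psum _ _ _ (fun k => (p k).[y]) (r + s)) //; field; rewrite yr ys.
  by rewrite mulr_ge0 // exprn_ge0 // ltW.
case: FN => sF <-; rewrite leNgt; apply/negP => FN0.
have sN : size F = N.+1.
  apply/eqP; rewrite eqn_leq sF ltnNge; apply/negP => sF'.
  by rewrite nth_default ?ltxx in FN0.
have lF : lead_coef (- F) = - F`_N by rewrite lead_coefN lead_coefE sN.
have [|y0 yF] := @poly_pinfty_gt_lc _ (- F); first by rewrite lF oppr_gt0.
have y1 : 0 < Num.max y0 1 by rewrite lt_max ltr01 orbT.
have := yF (Num.max y0 1); rewrite le_max lexx hornerN lF => /(_ isT).
by rewrite lerN2 leNgt (lt_le_trans FN0 (Fpos _ y1)).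
Qed.

(** At every real y, and at infinity, the perturbation parameter is positive (its top
    coefficient is t), so the perturbed polynomial has n distinct real roots. Its Hankel matrix
    is then positive definite on the real line, with a determinant of full degree n (n - 1). *)
Theorem strict_pencil n (p : nat -> {poly R}) t : (0 < n)%N ->
  p 0%N = 1 -> (forall k, (n < k)%N -> p k = 0) ->
  (forall k, (size (p k) <= k.+1)%N) ->
  (forall y, hankel_psd n (fun k => (p k).[y])) -> 0 < t ->
  exists P Q : 'M[R[i]]_n, [/\ P \is hermsymmx, Q \is hermsymmx & forall m,
    \tr ((polyC_mx P + 'X *: polyC_mx Q) ^+ m) =
    map_poly toC (psum n (cos_coef n (t *: (1 + 'X^2)) p) m)].
Proof.
move=> n0 p0 pn sp psd t0.
pose p' := cos_coef n (t *: (1 + 'X^2)) p; pose pC := map_poly toC \o p'.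
pose H := hankel_psum n pC; pose c := companion_col n pC.
pose tp k := (p k)`_k.
have p'n k : (n < k)%N -> p' k = 0 by move=> nk; rewrite /p' /cos_coef leqNgt nk.
have pCn k : (n < k)%N -> pC k = 0 by move=> nk; rewrite /pC /= p'n // rmorph0.
have top_p' k : has_top k (p' k) (cos_coef n t tp k).
  apply: has_top_cos => //; split.
    apply: leq_trans (size_scale_leq _ _) _; apply: leq_trans (size_polyD _ _) _.
    by rewrite size_poly1 size_polyXn.
  by rewrite coefZ coefD coef1 coefXn add0r mulr1.
have HE m : psum n pC m = map_poly toC (psum n p' m) by rewrite psum_morph.
have evp y k : (p' k).[y] = cos_coef n (t * (1 + y ^+ 2)) (fun k => (p k).[y]) k.
  rewrite -[LHS]/(horner_eval y _) cos_coef_morph /= /horner_eval.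
  by rewrite hornerZ hornerD hornerC hornerXn.
have evC y : (horner_eval y%:C \o pC) =1
    toC \o cos_coef n (t * (1 + y ^+ 2)) (fun k => (p k).[y]).
  by move=> k; rewrite /= /horner_eval horner_map -evp.
have ty y : 0 < t * (1 + y ^+ 2).
  by rewrite mulr_gt0 // ltr_pwDl ?ltr01 // sqr_ge0.
have topC m : has_top m (psum n pC m) (toC (psum n (cos_coef n t tp) m)).
  have [s1 <-] := has_top_psum n m top_p'; rewrite HE.
  by split; rewrite ?size_map_poly ?coef_map.
have conjC (f : {poly R}) : map_poly Num.conj (map_poly toC f) = map_poly toC f.
  by apply/polyP=> i; rewrite !coef_map /= conj_Creal // real_toC.
have Hherm : cadj H = H.
  by apply/matrixP=> r s; rewrite !mxE HE conjC addnC.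
have cadjc : cadj c = c^T.
  apply/matrixP=> r s; rewrite !mxE; case: ifP => _; rewrite ?rmorphN ?rmorph_nat //.
  by rewrite /pC /= conjC.
have HT : H^T = H by apply/matrixP=> r s; rewrite !mxE addnC.
have Hc : H *m c = cadj c *m H.
  rewrite cadjc -{2}HT -trmx_mul hankel_companion //.
  by apply/matrixP=> r s; rewrite !mxE addnC.
have sH r s : (size (H r s) <= (r + s).+1)%N by rewrite mxE; have [] := topC (r + s)%N.
have sc (m : nat) (w : 'M[{poly R[i]}]_(m, n)) :
    (forall i s, size (w i s) <= s.+1)%N -> forall i s, (size ((w *m c) i s) <= s.+1 + 1)%N.
  move=> sw i s; rewrite mul_companion addn1; case: insubP => [k _ <- //|].
  rewrite -leqNgt => ns; have sE : s.+1 = n by apply/eqP; rewrite eqn_leq ltn_ord.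
  rewrite size_polyN sE; apply: leq_trans (size_sum _ _ _) _; apply/bigmax_leqP=> k _.
  apply: leq_trans (size_polyMleq _ _) _; rewrite size_map_poly.
  have [sp' _] := top_p' (n - k)%N; have := sw i k; have := ltn_ord k.
  move: sp'; move: (size (polyseq (w i k))) (size (polyseq (p' (n - k)%N))) => a b.
  by clear; lia.
have Hpos y (v : 'cV[R[i]]_n) : y \is Num.real -> v != 0 ->
    0 < (v^t* *m eval_mx y H *m v) 0 0.
  case/complex_realP => {}y -> vn0.
  have q0 : (p 0%N).[y] = 1 by rewrite p0 hornerC.
  have qn k : (n < k)%N -> (p k).[y] = 0 by move=> nk; rewrite pn // horner0.
  have := cos_hankel_pos (q := fun k => (p k).[y]) n0 q0 qn (psd y) (ty y) vn0.
  rewrite eval_mxE map_hankel_psum.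
  congr (0 < (_ *m _ *m _) _ _).
  by apply/matrixP=> r s; rewrite !mxE; apply: eq_psum => // k _; rewrite evC.
(* the top coefficient of the determinant is the Hankel determinant at infinity *)
have sD : (n * n.-1 < size (\det H))%N.
  pose T := hankel_psum n (toC \o cos_coef n t tp).
  have [_] : has_top (\sum_(i < n) i + \sum_(i < n) i) (\det H) (\det T).
    apply: has_top_det => i j; rewrite !mxE.
    by have := topC (i + j)%N; rewrite -(psum_morph (real_complex R)).
  rewrite addnn double_sum_ord ltnNge => detT; apply/negP => sH'.
  move: detT; rewrite nth_default // => /esym/eqP/det0P[v vn0 vT].
  have vtn0 : v^t* != 0.
    by apply: contraNneq vn0 => v0'; rewrite -[v]trmxCK v0' trmx0 map_mx0.
  have tp0 : tp 0%N = 1 by rewrite /tp p0 coef1.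
  have tpn k : (n < k)%N -> tp k = 0 by move=> nk; rewrite /tp pn // coef0.
  have tpsd : hankel_psd n tp by apply: (psd_top n0 _ psd) => k.
  by have := cos_hankel_pos n0 tp0 tpn tpsd t0 vtn0; rewrite trmxCK -/T vT mul0mx mxE ltxx.
have [P [Q [Ph Qh PQ]]] := hermitian_pencil Hherm Hc sH sc Hpos sD.
exists P, Q; split=> // m; rewrite PQ -/p' -HE; apply: poly_eq_nat => k.
rewrite -(rmorph_nat toC k) -![_.[_]]/(horner_eval _ _).
have -> : horner_eval (toC k%:R) (\tr (c ^+ m)) =
    \tr (companion_col n (horner_eval (toC k%:R) \o pC) ^+ m).
  rewrite -map_companion -/c -trace_map_mx; congr (\tr _).
  elim: m => [|m IH]; first by rewrite !expr0 map_mx1.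
  by rewrite !exprS -!mulmxE map_mxM IH.
rewrite psum_morph (eq_companion _ (evC _)) (eq_psum (M := m) _ (fun k _ => evC _ k)) //.
have [|j nj|l [sl ul lR lE]] :=
  @cos_coef_split n (fun j => (p j).[k%:R]) _ n0 _ _ (psd _) (ty k%:R).
- by rewrite p0 hornerC.
- by rewrite pn // horner0.
apply: trace_companion lE ul => [j nj|]; first by rewrite /= /cos_coef leqNgt nj.
by rewrite /= cos_coef0 p0 hornerC.
Qed.

End Strict.

(** * Traces of words and necessity *)

Lemma sum_tuple_cons (V : nmodType) (T : finType) m (F : m.+1.-tuple T -> V) :
  \sum_w F w = \sum_b \sum_(w : m.-tuple T) F [tuple of b :: w].
Proof.
rewrite pair_big /= (reindex (fun bw : T * m.-tuple T => [tuple of bw.1 :: bw.2])) //=.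
exists (fun w => (thead w, [tuple of behead w])) => [[b w] _|w _] /=.
  by congr pair; apply/val_inj.
by rewrite [RHS]tuple_eta.
Qed.

Lemma pencil_exp (C : comNzRingType) n (P Q : 'M[C]_n) m :
  (polyC_mx P + 'X *: polyC_mx Q) ^+ m =
  \sum_(w : m.-tuple bool) 'X^(count_mem true w) *: polyC_mx (word_eval P Q w).
Proof.
elim: m => [|m IH].
  rewrite (big_pred1 [tuple]) => [|w]; last by apply/esym/eqP/val_inj; case: w => -[].
  by rewrite !expr0 /word_eval big_nil scale1r /polyC_mx map_mx1.
rewrite exprS IH sum_tuple_cons big_bool -big_split mulr_sumr /=.
apply: eq_bigr => w _; rewrite /word_eval !big_cons /polyC_mx !map_mxM /= add0n add1n.
by rewrite -mulmxE mulmxDl addrC -!scalemxAr -scalemxAl scalerA exprSr.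
Qed.

Lemma coef_trace_pencil (C : comNzRingType) n (P Q : 'M[C]_n) m k :
  (\tr ((polyC_mx P + 'X *: polyC_mx Q) ^+ m))`_k = word_trace_sum P Q m k.
Proof.
rewrite pencil_exp raddf_sum coef_sum /word_trace_sum [RHS]big_mkcond.
apply: eq_bigr => w _ /=; rewrite mxtraceZ /polyC_mx trace_map_mx coefXnM coefC.
by rewrite ltnNge subn_eq0 eqn_leq; case: (_ <= k)%N; case: (k <= _)%N.
Qed.

Lemma word_trace_sum0 (C : comNzRingType) n (P Q : 'M[C]_n) m k : (m < k)%N ->
  word_trace_sum P Q m k = 0.
Proof.
move=> mk; rewrite /word_trace_sum big1 // => w /eqP wk.
by have := count_size (pred1 true) w; rewrite size_tuple wk leqNgt mk.
Qed.

Lemma coef_hpoly (R : realType) (s : nat -> nat -> R) m k :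
  (hpoly s m)`_k = if (k <= m)%N then s m k else 0.
Proof.
by rewrite /hpoly big_mkord -(poly_def _ (s m)) coef_poly.
Qed.

Lemma hermitian_trace_exp (C : numClosedFieldType) n (A : 'M[C]_n) : A \is hermsymmx ->
  exists2 a : 'rV[C]_n, (forall i, a 0 i \is Num.real) &
    forall m, \tr (A ^+ m) = \sum_i a 0 i ^+ m.
Proof.
move=> Ah; have /orthomx_spectralP AE := hermitian_normalmx Ah.
exists (spectral_diag A) => [i|m].
  by have /mxOverP := hermitian_spectral_diag_real Ah; apply.
have Pu := spectral_unit A.
rewrite -trace_diag_exp; symmetry; apply: (similar_trace (Q := spectralmx A)).
  by rewrite -unitfE -unitmxE.
by rewrite [X in _ = _ *m X]AE !mulmxA mulmxV // mul1mx.
Qed.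

Section Forward.
Variables (R : realType) (n : nat) (s : nat -> nat -> R) (P Q : 'M[R[i]]_n).
Hypothesis n0 : (0 < n)%N.
Hypotheses (Ph : P \is hermsymmx) (Qh : Q \is hermsymmx).
Hypothesis PQs : forall m k : nat, (k <= m <= 2 * n - 2)%N ->
  word_trace_sum P Q m k = (s m k)%:C.

Lemma pencil_hermitian (y : R) : P + y%:C *: Q \is hermsymmx.
Proof.
move/is_hermitianmxP: Ph; move/is_hermitianmxP: Qh; rewrite expr0 !scale1r => Qe Pe.
apply/is_hermitianmxP; rewrite expr0 scale1r {1}Pe {1}Qe.
by apply/matrixP=> i j; rewrite !mxE rmorphD rmorphM /= (conj_Creal (real_toC y)).
Qed.

Lemma hpoly_trace m (y : R) : (m <= 2 * n - 2)%N ->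
  ((hpoly s m).[y])%:C = \tr ((P + y%:C *: Q) ^+ m).
Proof.
move=> mn; rewrite -horner_map /=.
have -> : map_poly (real_complex R) (hpoly s m) =
    \tr ((polyC_mx P + 'X *: polyC_mx Q) ^+ m).
  apply/polyP=> k; rewrite coef_map coef_hpoly coef_trace_pencil /=.
  by case: leqP => km; [rewrite -PQs ?km | rewrite word_trace_sum0].
rewrite -[_.[_]]/(horner_eval _ _) -trace_map_mx; congr (\tr _).
have -> : P + y%:C *: Q = map_mx (horner_eval y%:C) (polyC_mx P + 'X *: polyC_mx Q).
  by apply/matrixP=> i j; rewrite !mxE /horner_eval hornerD hornerM hornerX !hornerC.
elim: m {mn} => [|m IH]; first by rewrite !expr0 map_mx1.
by rewrite !exprS -!mulmxE map_mxM IH.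
Qed.

(** The form is the sum of the squares of v_0 + v_1 a + ... over the real eigenvalues a. *)
Lemma hankel_mx_psd (y : R) : psdmx (map_mx (horner_eval y) (hankel_mx (hpoly s) n)).
Proof.
split; first by apply/matrixP=> i j; rewrite !mxE addnC.
move=> v; have [a aR atr] := hermitian_trace_exp (pencil_hermitian y).
rewrite -ler0c (_ : _%:C = \sum_i (\sum_(r < n) (v r 0)%:C * a 0 i ^+ r) ^+ 2).
  apply: sumr_ge0 => i _; rewrite real_exprn_even_ge0 //.
  by apply: rpred_sum => r _; rewrite rpredM ?real_toC ?rpredX.
rewrite mxE rmorph_sum; under eq_bigr => r _ do
  rewrite mxE rmorphM rmorph_sum mulr_suml.
under [in RHS]eq_bigr => i _ do
  (rewrite expr2 mulr_suml; under eq_bigr => r _ do rewrite mulr_sumr).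
rewrite [in RHS]exchange_big /= exchange_big; apply: eq_bigr => r _.
rewrite [in RHS]exchange_big; apply: eq_bigr => t _.
rewrite !mxE rmorphM /= /horner_eval hpoly_trace ?atr; last first.
  by have := ltn_ord r; have := ltn_ord t; lia.
by rewrite mulr_sumr mulr_suml; apply: eq_bigr => i _; rewrite exprD; ring.
Qed.

(** Newton's identities determine the coefficients of the characteristic polynomial of P + yQ
    from the traces of its powers, by the recursion that defines newton. *)
Lemma newton_eval (y : R) (a : 'rV[R[i]]_n) :
  (forall m, \tr ((P + y%:C *: Q) ^+ m) = \sum_i a 0 i ^+ m) ->
  forall j, (0 < j <= 2 * n - 2)%N ->
  ((newton (hpoly s) j).[y])%:C = (rev_roots [seq a 0 i | i <- enum 'I_n])`_j.
Proof.
move=> atr; set l := [seq _ | i <- _].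
have ltr m : (m <= 2 * n - 2)%N -> ((hpoly s m).[y])%:C = \sum_(b <- l) b ^+ m.
  by move=> mn; rewrite hpoly_trace // atr big_map big_enum.
elim/ltn_ind => j IH /andP[j0 jn]; rewrite newtonE //.
have jn0 : (j%:R : R[i]) != 0 by rewrite pnatr_eq0 -lt0n.
have := newton_identity l j.
rewrite -(big_mkord xpredT (fun i => (rev_roots l)`_i * \sum_(b <- l) b ^+ (j - i))).
rewrite big_ltn // subn0 -ltr // [_`_0]coef_rev_roots leq0n subn0.
have -> : (\prod_(b <- l) ('X - b%:P))`_(size l) = 1.
  have := monicP (monic_prod_XsubC l xpredT id).
  by rewrite lead_coefE size_prod_XsubC.
rewrite mul1r big_nat_rev /= add1n => /eqP; rewrite addr_eq0 => /eqP e.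
apply: (mulfI jn0); rewrite e hornerN hornerZ rmorphN rmorphM /= fmorphV rmorph_nat.
rewrite mulrN mulrA divff // mul1r hornerD rmorphD /=.
congr (- (_ + _)); rewrite horner_sum rmorph_sum; apply: eq_big_nat => k /andP[k0 kj].
rewrite hornerM rmorphM /= IH ?ltr 1?mulrC //; try lia.
by rewrite subSS subKn // ltnW.
Qed.

Lemma newton_vanish j : (n + 1 <= j <= 2 * n - 2)%N -> newton (hpoly s) j = 0.
Proof.
move=> /andP[nj jn]; apply: poly_eq_nat => k.
have [a _ atr] := hermitian_trace_exp (pencil_hermitian k%:R).
apply: (@complexI R); rewrite horner0 (newton_eval atr); last by lia.
by rewrite coef_rev_roots size_map size_enum_ord leqNgt (_ : (n < j)%N = true) //; lia.
Qed.

End Forward.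

(** * Limits of Hermitian pencils *)

Section Compactness.
Import classical_sets filter topology normedtype derive.
Import numFieldNormedType.Exports.

Section Continuity.
Variables (R : realType) (T : topologicalType).

(** Continuity of the two real coordinates: only the topology of R enters. *)
Definition ccont (f : T -> R[i]) :=
  continuous (fun x => complex.Re (f x) : R) /\ continuous (fun x => complex.Im (f x) : R).

Lemma ccont_cst c : ccont (fun=> c).
Proof. by split; apply: cst_continuous. Qed.

Lemma ccontD f g : ccont f -> ccont g -> ccont (fun x => f x + g x).
Proof.
move=> [f1 f2] [g1 g2].
have -> : (fun x => f x + g x) = (fun x =>
    (complex.Re (f x) + complex.Re (g x)) +i* (complex.Im (f x) + complex.Im (g x))).
  by apply: boolp.funext => x; case: (f x); case: (g x).
by split=> x; apply: cvgD; [apply: f1 | apply: g1 | apply: f2 | apply: g2].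
Qed.

Lemma ccontM f g : ccont f -> ccont g -> ccont (fun x => f x * g x).
Proof.
move=> [f1 f2] [g1 g2].
have -> : (fun x => f x * g x) = (fun x =>
    (complex.Re (f x) * complex.Re (g x) - complex.Im (f x) * complex.Im (g x)) +i*
    (complex.Re (f x) * complex.Im (g x) + complex.Im (f x) * complex.Re (g x))).
  by apply: boolp.funext => x; case: (f x) => a b; case: (g x) => c d.
by split=> x; [apply: cvgB | apply: cvgD]; apply: cvgM;
  [apply: f1 | apply: g1 | apply: f2 | apply: g2 |
   apply: f1 | apply: g2 | apply: f2 | apply: g1].
Qed.

Lemma ccont_conj f : ccont f -> ccont (fun x => (f x)^*%R).
Proof.
move=> [f1 f2].
have -> : (fun x => (f x)^*%R) = (fun x => complex.Re (f x) +i* - complex.Im (f x)).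
  by apply: boolp.funext => x; case: (f x).
by split=> x; [apply: f1 | apply: cvgN; apply: f2].
Qed.

Lemma ccont_sum I (r : seq I) (P : pred I) (F : I -> T -> R[i]) :
  (forall i, ccont (F i)) -> ccont (fun x => \sum_(i <- r | P i) F i x).
Proof.
move=> FC; elim: r => [|i r IH].
  rewrite (_ : (fun x => _) = fun=> 0); first exact: ccont_cst.
  by apply: boolp.funext => x; rewrite big_nil.
rewrite (_ : (fun x => _) =
    fun x => (if P i then F i x else 0) + \sum_(j <- r | P j) F j x).
  by apply: ccontD => //; case: (P i) => //; apply: ccont_cst.
by apply: boolp.funext => x; rewrite big_cons; case: (P i); rewrite ?add0r.
Qed.

Lemma ccont_word_trace n (P Q : T -> 'M[R[i]]_n) m k :
  (forall i j, ccont (fun x => P x i j)) -> (forall i j, ccont (fun x => Q x i j)) ->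
  ccont (fun x => word_trace_sum (P x) (Q x) m k).
Proof.
move=> PC QC; apply: ccont_sum => w; apply: ccont_sum => i.
suff H (s : seq bool) i' j' : ccont (fun x => word_eval (P x) (Q x) s i' j') by apply: H.
elim: s i' j' => [|b s IH] i' j'.
  by rewrite /word_eval; under boolp.eq_fun do rewrite big_nil; apply: ccont_cst.
rewrite (_ : (fun x => _) = fun x =>
    \sum_l (if b then Q x else P x) i' l * word_eval (P x) (Q x) s l j').
  by apply: ccont_sum => l; apply: ccontM => //; case: b.
by apply: boolp.funext => x; rewrite /word_eval big_cons mxE; case: b.
Qed.

End Continuity.

Section Limit.
Variables (R : realType) (n : nat).

Local Notation index := (bool * bool * 'I_n * 'I_n)%type.
Local Notation space := (prod_topology (fun _ : index => (R : topologicalType))).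

(** Adding the conjugate transpose makes every coordinate vector describe a Hermitian matrix,
    so that a plain box of coordinates is a compact set of Hermitian pairs. *)
Definition herm_of_coords (X : index -> R) (b : bool) : 'M[R[i]]_n :=
  \matrix_(i, j) ((X (b, false, i, j) +i* X (b, true, i, j)) +
                  (X (b, false, j, i) +i* X (b, true, j, i))^*%R).

Lemma herm_of_coords_herm X b : herm_of_coords X b \is hermsymmx.
Proof.
apply/is_hermitianmxP; rewrite expr0 scale1r; apply/matrixP=> i j.
by rewrite !mxE rmorphD /= conjCK addrC.
Qed.

Definition herm_coords (P Q : 'M[R[i]]_n) (x : index) : R :=
  let: (b, c, i, j) := x in
  let z := (if b then Q else P) i j in
  (if c then complex.Im z else complex.Re z) / 2%:R.

Lemma herm_coordsK P Q b : P \is hermsymmx -> Q \is hermsymmx ->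
  herm_of_coords (herm_coords P Q) b = if b then Q else P.
Proof.
move=> Ph Qh; have Mh : (if b then Q else P) \is hermsymmx by case: b.
apply/matrixP=> i j; rewrite mxE /=; set M := if b then Q else P in Mh *.
move/is_hermitianmxP: Mh; rewrite expr0 scale1r => /matrixP/(_ j i).
rewrite !mxE; case: (M i j) => x y -> /=; apply/eqP; rewrite eq_complex /=.
by apply/andP; split; apply/eqP; field.
Qed.

Lemma ccont_herm_of_coords b i j :
  ccont (fun X : space => herm_of_coords X b i j).
Proof.
have Z c k l : continuous (fun X : space => (X (b, c, k, l) : R)).
  by move=> X; apply: (@proj_continuous _ (fun _ : index => (R : topologicalType)) (b, c, k, l)).
rewrite (_ : (fun X => _) = fun X : space => (X (b, false, i, j) +i* X (b, true, i, j)) +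
                  (X (b, false, j, i) +i* X (b, true, j, i))^*%R).
  by apply: ccontD; [|apply: ccont_conj]; split; apply: Z.
by apply: boolp.funext => X; rewrite mxE.
Qed.

(** The sum F of the squared defects attains its minimum on a compact box. Its values along
    the approximations are those of a polynomial in t without constant term, so the minimum
    is 0. *)
Lemma pencil_limit N (g : nat -> nat -> {poly R}) (B : R) :
  (forall t, 0 < t <= 1 -> exists P Q : 'M[R[i]]_n,
    [/\ P \is hermsymmx, Q \is hermsymmx,
        forall x, `|herm_coords P Q x| <= B &
        forall m k, word_trace_sum P Q m k = (g m k).[t]%:C]) ->
  exists P Q : 'M[R[i]]_n, [/\ P \is hermsymmx, Q \is hermsymmx &
    forall m k, (m < N)%N -> (k < N)%N -> word_trace_sum P Q m k = (g m k).[0]%:C].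
Proof.
move=> approx.
pose defect (X : space) (m k : nat) : R[i] :=
  word_trace_sum (herm_of_coords X false) (herm_of_coords X true) m k - (g m k).[0]%:C.
pose F (X : space) := \sum_(m < N) \sum_(k < N) defect X m k * (defect X m k)^*%R.
have defectC m k : ccont (fun X => defect X m k).
  apply: ccontD; last exact: ccont_cst.
  by apply: ccont_word_trace => i j; apply: ccont_herm_of_coords.
have [FC _] : ccont F.
  apply: ccont_sum => m; apply: ccont_sum => k.
  by apply: ccontM => //; apply: ccont_conj.
pose K : set space := [set X | forall x, `[- B, B]%classic (X x)]%classic.
have Kcpt : compact K.
  apply: (@tychonoff _ (fun _ : index => (R : topologicalType))
    (fun _ => `[- B, B]%classic)) => x.
  exact: segment_compact.
pose gam := \sum_(m < N) \sum_(k < N) (g m k - (g m k).[0]%:P) ^+ 2.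
have test t : 0 < t <= 1 -> exists2 X, K X & F X = gam.[t]%:C.
  move=> t01; have [P [Q [Ph Qh PQB PQg]]] := approx t t01.
  exists (herm_coords P Q) => [x|]; first by rewrite /= in_itv /= -ler_norml.
  rewrite /F /gam horner_sum rmorph_sum; apply: eq_bigr => m _.
  rewrite horner_sum rmorph_sum; apply: eq_bigr => k _.
  rewrite /defect !herm_coordsK // PQg -rmorphB /= conj_Creal ?real_toC //.
  by rewrite -rmorphM /= horner_exp hornerD hornerN hornerC expr2.
have K0 : (K !=set0)%classic.
  by have [|X KX _] := test 1; [rewrite ltr01 lexx | exists X].
have [X0 _ X0min] := compact_EVT_min K0 Kcpt (continuous_subspaceT FC).
have F0 : 0 <= F X0.
  by apply: sumr_ge0 => m _; apply: sumr_ge0 => k _; rewrite mul_conjC_ge0.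
have gam0 : root gam 0.
  apply/rootP; rewrite /gam horner_sum big1 // => m _; rewrite horner_sum big1 // => k _.
  by rewrite horner_exp hornerD hornerN hornerC subrr expr0n.
have [q qE] := factor_theorem _ _ gam0.
have [ub ubP] := poly_itv_bound q 0 1.
have FX0 : F X0 = 0.
  move: F0; rewrite lecE /= => /andP[/eqP ImF ReF].
  suff ReF0 : complex.Re (F X0) <= 0.
    by apply/eqP; rewrite eq_complex /= ImF eqxx andbT eq_le ReF0.
  rewrite leNgt; apply/negP => e0; set e := complex.Re _ in e0.
  pose t := Num.min 1 (e / (2 * (`|ub| + 1))).
  have c0 : 0 < `|ub| + 1 by rewrite ltr_wpDl.
  have t0 : 0 < t by rewrite lt_min ltr01 divr_gt0 // mulr_gt0.
  have t1 : t <= 1 by rewrite ge_min lexx.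
  have [|X KX FX] := test t; first by rewrite t0.
  have := X0min X; rewrite inE => /(_ KX); rewrite FX /= -/e qE.
  rewrite hornerM hornerXsubC subr0 leNgt => /negP; apply.
  have qt : q.[t] <= `|ub|.
    apply: le_trans (ler_norm _) _; apply: le_trans (ler_norm ub).
    by apply: ubP; rewrite ltW.
  have te : t * (2 * (`|ub| + 1)) <= e.
    by rewrite -ler_pdivlMr ?mulr_gt0 // ge_min lexx orbT.
  have : q.[t] * t <= `|ub| * t by rewrite ler_pM2r.
  move=> /le_lt_trans; apply; nra.
exists (herm_of_coords X0 false), (herm_of_coords X0 true).
split; try exact: herm_of_coords_herm.
move=> m k mN kN; apply/eqP; rewrite -subr_eq0 -[_ - _]/(defect X0 m k).
have nn (m' : 'I_N) : 0 <= \sum_(k < N) defect X0 m' k * (defect X0 m' k)^*%R.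
  by apply: sumr_ge0 => k' _; rewrite mul_conjC_ge0.
have e1 : \sum_(k < N) defect X0 m k * (defect X0 m k)^*%R = 0.
  exact: (psumr_eq0P (fun m' _ => nn m') FX0 (i := Ordinal mN)).
have nn' (k' : 'I_N) : 0 <= defect X0 m k' * (defect X0 m k')^*%R by rewrite mul_conjC_ge0.
by rewrite -mul_conjC_eq0 (psumr_eq0P (fun k' _ => nn' k') e1 (i := Ordinal kN)).
Qed.

End Limit.

End Compactness.

(** * Sufficiency *)

Lemma word_trace_sum_sqr (C : comNzRingType) n (P Q : 'M[C]_n) :
  word_trace_sum P Q 2 0 = \tr (P ^+ 2) /\ word_trace_sum P Q 2 2 = \tr (Q ^+ 2).
Proof.
rewrite /word_trace_sum; split; rewrite big_mkcond !sum_tuple_cons !big_bool /=;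
  rewrite !sum_tuple_cons !big_bool /= !(big_pred1 [tuple]) /=;
  try (by move=> w; apply/esym/eqP/val_inj; case: w => -[]);
  rewrite ?add0r ?addr0 /word_eval !big_cons big_nil mulmx1 expr2 -mulmxE //.
Qed.

(** For Hermitian M the trace of M^2 is the sum of the |M_ij|^2. *)
Lemma herm_entry_bound (R : realType) n (M : 'M[R[i]]_n) (x ub : R) i j :
  M \is hermsymmx -> \tr (M ^+ 2) = x%:C -> `|x| <= ub ->
  `|complex.Re (M i j)| <= 1 + ub /\ `|complex.Im (M i j)| <= 1 + ub.
Proof.
move=> /is_hermitianmxP; rewrite expr0 scale1r => Mh trM xub.
have ub0 : 0 <= ub by apply: le_trans xub.
have Mji k l : M l k = (M k l)^*%R by rewrite {1}Mh !mxE.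
have trE : \tr (M ^+ 2) = \sum_k \sum_l M k l * (M k l)^*%R.
  rewrite expr2 -mulmxE; apply: eq_bigr => k _; rewrite mxE.
  by apply: eq_bigr => l _; rewrite -Mji.
have : M i j * (M i j)^*%R <= x%:C.
  rewrite -trM trE (bigD1 i) //= (bigD1 j) //= -addrA lerDl addr_ge0 //.
    by apply: sumr_ge0 => l _; rewrite mul_conjC_ge0.
  by apply: sumr_ge0 => k _; apply: sumr_ge0 => l _; rewrite mul_conjC_ge0.
case: (M i j) => a b; rewrite lecE /= => /andP[_ abx].
have xub' : x <= ub by apply: le_trans xub; apply: ler_norm.
by split; rewrite ler_norml; apply/andP; split; nra.
Qed.

Lemma newton_size (R : realType) (s : nat -> nat -> R) j :
  (size (newton (hpoly s) j) <= j.+1)%N.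
Proof.
have sh m : (size (hpoly s m) <= m.+1)%N.
  by rewrite /hpoly big_mkord -(poly_def _ (s m)) size_poly.
elim/ltn_ind: j => -[|j] IH; first by rewrite /newton /= size_poly0.
rewrite newtonE // size_polyN; apply: leq_trans (size_scale_leq _ _) _.
apply: leq_trans (size_polyD _ _) _; rewrite geq_max sh /= big_seq.
apply: leq_trans (size_sum _ _ _) _; apply/bigmax_leqP_seq => k kj _.
move: kj; rewrite mem_index_iota => /andP[k0 kj].
apply: leq_trans (size_polyMleq _ _) _; have := sh k; have := IH (j.+1 - k)%N.
have -> : (j.+1 - k < j.+1)%N by lia.
move=> /(_ isT); move: (size (polyseq (newton _ _))) (size (polyseq (hpoly s k))).
move: k0 kj; clear; lia.
Qed.

Section Backward.
Variables (R : realType) (n : nat) (s : nat -> nat -> R).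
Hypothesis n0 : (0 < n)%N.
Hypothesis s00 : s 0%N 0%N = n%:R.
Hypothesis psd : forall y : R, psdmx (map_mx (horner_eval y) (hankel_mx (hpoly s) n)).
Hypothesis vanish : forall j : nat, (n + 1 <= j <= 2 * n - 2)%N -> newton (hpoly s) j = 0.

Let p (k : nat) : {poly R} :=
  if k is 0 then 1 else if (k <= n)%N then newton (hpoly s) k else 0.

Let p_gt k : (n < k)%N -> p k = 0.
Proof. by case: k => // k nk; rewrite /p leqNgt nk. Qed.

Lemma psum_newton m : (m <= 2 * n - 2)%N -> hpoly s m = psum n p m.
Proof.
move: m; apply: psum_uniq => [|m /andP[m0 mn]].
  by rewrite /hpoly big_nat1 expr0 alg_polyC s00 polyC_natr.
have pN k : (0 < k <= m)%N -> p k = newton (hpoly s) k.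
  case: k => // k /andP[_ km]; rewrite /p; case: ifP => // /negbT; rewrite -ltnNge => nk.
  by rewrite vanish //; lia.
rewrite pN ?m0 ?leqnn // newtonE //.
rewrite (@eq_big_nat _ _ _ 1 m (fun k => p k * hpoly s (m - k))
  (fun k => hpoly s (m - k) * newton (hpoly s) k)); last first.
  by move=> k /andP[k0 km]; rewrite pN 1?mulrC // k0 ltnW.
rewrite [X in _ + X]big_nat_rev /= add1n.
rewrite (@eq_big_nat _ _ _ 1 m (fun k => hpoly s (m - (m.+1 - k.+1)) * _)
  (fun k => hpoly s k * newton (hpoly s) (m - k))); last first.
  by move=> k /andP[k0 km]; rewrite subSS subKn // ltnW.
have m_n0 : (m%:R : R) != 0 by rewrite pnatr_eq0 -lt0n.
rewrite mulrN -scalerAr mulr_natl -scaler_nat scalerA mulVf // scale1r.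
by rewrite addrAC subrr.
Qed.

Let size_p k : (size (p k) <= k.+1)%N.
Proof.
case: k => [|k]; first by rewrite size_poly1.
by rewrite /p; case: ifP => _; rewrite ?newton_size ?size_poly0.
Qed.

Let p_psd y : hankel_psd n (fun k => (p k).[y]).
Proof.
move=> v; have [_ /(_ (\col_i v i))] := psd y.
congr (0 <= _); rewrite mxE exchange_big; apply: eq_bigr => r _.
rewrite mxE mulr_suml; apply: eq_bigr => t _; rewrite !mxE /horner_eval.
rewrite psum_newton; last by have := ltn_ord r; have := ltn_ord t; lia.
by rewrite -[(psum n p _).[y]]/(horner_eval y _) psum_morph; ring.
Qed.

Let tau : {poly {poly R}} := 'X%:P * (1 + 'X^2).
Let g m k : {poly R} := (psum n (cos_coef n tau (map_poly polyC \o p)) m)`_k.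

Let gE t m k : (g m k).[t] = (psum n (cos_coef n (t *: (1 + 'X^2)) p) m)`_k.
Proof.
rewrite -[LHS]/(horner_eval t _) /g -coef_map psum_morph; congr ((polyseq _)`_ _).
apply: (@eq_psum _ n _ _ m) => // j _.
transitivity (cos_coef n (map_poly (horner_eval t) tau)
  (map_poly (horner_eval t) \o (map_poly polyC \o p)) j); first exact: cos_coef_morph.
have -> : map_poly (horner_eval t) tau = t *: (1 + 'X^2).
  rewrite /tau rmorphM rmorphD rmorphXn rmorph1 /= map_polyX map_polyC /=.
  by rewrite /horner_eval hornerX mul_polyC.
apply: eq_cos_coef => i /=; apply/polyP => l.
by rewrite !coef_map /= /horner_eval hornerC.
Qed.

(** The coefficients of the perturbed power sums are polynomials g m k in the parameter t,
    with the prescribed values at t = 0. The pencils of strict_pencil stay bounded for t <= 1,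
    as the traces of P^2 and Q^2 are among these coefficients, and pencil_limit applies. *)
Lemma moments_realized : exists P Q : 'M[R[i]]_n,
  P \is hermsymmx /\ Q \is hermsymmx /\
  forall m k : nat, (k <= m <= 2 * n - 2)%N -> word_trace_sum P Q m k = (s m k)%:C.
Proof.
have [ub0 ub0P] := poly_itv_bound (g 2 0) 0 1.
have [ub2 ub2P] := poly_itv_bound (g 2 2) 0 1.
have ub00 : 0 <= ub0 by apply: le_trans (ub0P 0 _); rewrite ?lexx ?ler01.
have ub20 : 0 <= ub2 by apply: le_trans (ub2P 0 _); rewrite ?lexx ?ler01.
have [|P [Q [Ph Qh PQ]]] := @pencil_limit R n (2 * n).+1 g (1 + (ub0 + ub2)).
  move=> t /andP[t0 t1].
  have [P [Q [Ph Qh PQ]]] := strict_pencil n0 (erefl : p 0%N = 1) p_gt size_p p_psd t0.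
  have PQg m k : word_trace_sum P Q m k = (g m k).[t]%:C.
    by rewrite -coef_trace_pencil PQ coef_map gE.
  exists P, Q; split=> // -[[[b c] i] j] /=.
  have [trP trQ] := word_trace_sum_sqr P Q; rewrite !PQg in trP trQ.
  have t01 : 0 <= t <= 1 by rewrite ltW.
  have bP := ub0P t t01; have bQ := ub2P t t01.
  have [BRe BIm] : `|complex.Re ((if b then Q else P) i j)| <= 1 + (ub0 + ub2) /\
      `|complex.Im ((if b then Q else P) i j)| <= 1 + (ub0 + ub2).
    case: b; [apply: herm_entry_bound (esym trQ) _ |
              apply: herm_entry_bound (esym trP) _] => //.
      by apply: le_trans bQ _; rewrite lerDr.
    by apply: le_trans bP _; rewrite lerDl.
  rewrite normrM [`|2^-1|]ger0_norm ?invr_ge0 // ler_pdivrMr //.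
  by case: c; nra.
exists P, Q; split=> //; split=> // m k /andP[km mn].
rewrite PQ; [|lia|lia]; congr (_%:C); rewrite gE scale0r.
rewrite (@eq_psum _ n _ p m) => // [|j _].
  by rewrite -psum_newton // coef_hpoly km.
by case: (leqP j n) => jn; [rewrite cos_coef_tau0 | rewrite p_gt // /cos_coef leqNgt jn].
Qed.

End Backward.

Theorem theorem4p1 (R : realType) (n : nat) (hn : (1 <= n)%N)
    (s : nat -> nat -> R) (hs : s 0%N 0%N = n%:R) :
  (exists P Q : 'M[R[i]]_n,
     P \is hermsymmx /\ Q \is hermsymmx /\
     forall m k : nat, (k <= m <= 2 * n - 2)%N ->
       word_trace_sum P Q m k = (s m k)%:C)
  <->
  ((forall y : R, psdmx (map_mx (horner_eval y) (hankel_mx (hpoly s) n))) /\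
   (forall j : nat, (n + 1 <= j <= 2 * n - 2)%N -> newton (hpoly s) j = 0)).
Proof.
split=> [[P [Q [Ph [Qh PQ]]]]|[psd vanish]]; last exact: moments_realized hn hs psd vanish.
split=> [y|j]; [exact: hankel_mx_psd hn Ph Qh PQ y | exact: newton_vanish hn Ph Qh PQ j].
Qed.
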